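(* Let $n\ge2$, $k\ge3$. The rank $n$ Fock--Goncharov Poisson bracket $\{\cdot,\cdot\}_n$ for $\mathcal{X}_{\operatorname{PGL}_n,D_k}$ does not depend on the ideal triangulation: for any two ideal triangulations $\mathcal{T},\mathcal{T}'$ of $D_k$, the map $\mathcal{FX}(\mathcal{T}_n')\to\mathcal{FX}(\mathcal{T}_n)$ expressing the Fock--Goncharov coordinates of $\mathcal{T}_n'$ as rational functions of those of $\mathcal{T}_n$ is Poisson with respect to the rank $n$ Fock--Goncharov Poisson brackets associated with $\mathcal{T}'_n$ and $\mathcal{T}_n$.
   Context: $\mathbb{K}$ is a field of characteristic zero. $D_k$ is a disk with a set $m_b$ of $k$ marked points on its boundary circle, cyclically ordered anticlockwise (relation $\prec$). An ideal triangulation $\mathcal{T}$ is a triangulation of the $k$-gon with vertex set $m_b$. The moduli space is $\mathcal{X}_{\operatorname{PGL}_n,D_k}\cong\mathcal{B}^k/\operatorname{PGL}_n$, $\mathcal{B}$ the variety of complete flags in an $n$-dimensional space $E$ with fixed volume form $\Omega$: to each $\mathbf{r}\in m_b$ is attached a flag, and one chooses a basis $\mathbf{r}_1,\dots,\mathbf{r}_n$ of it (the first $i$ vectors span the $i$-dimensional subspace). Write $\mathbf{r}^i=\mathbf{r}_1\wedge\cdots\wedge\mathbf{r}_i$. The $n$-triangulation $\mathcal{T}_n$ subdivides every triangle of $\mathcal{T}$ into $n^2$ triangles: the vertices in a triangle with vertices $\mathbf{x},\mathbf{y},\mathbf{z}$ are $v_{\mathbf{x},\mathbf{y},\mathbf{z}}^{m,l,p}$,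 $m,l,p\ge0$, $m+l+p=n$ (barycentric coordinates $(m,l,p)/n$), vertices on a common side being identified. $\mathcal{J}_n$ is the set of vertices interior to triangles of $\mathcal{T}$, $\mathcal{I}_n$ the set of vertices on edges of $\mathcal{T}$ other than vertices of $\mathcal{T}$, and $\mathcal{I}_n'\subset\mathcal{I}_n$ those not on the boundary of the polygon. Quiver: in every triangle $\mathbf{x}\prec\mathbf{y}\prec\mathbf{z}\prec\mathbf{x}$ of $\mathcal{T}$ put arrows from $v^{a,b,c}_{\mathbf{x},\mathbf{y},\mathbf{z}}$ to $v^{a+1,b,c-1}_{\mathbf{x},\mathbf{y},\mathbf{z}}$, $v^{a-1,b+1,c}_{\mathbf{x},\mathbf{y},\mathbf{z}}$, $v^{a,b-1,c+1}_{\mathbf{x},\mathbf{y},\mathbf{z}}$ whenever both ends lie in $\mathcal{I}_n\cup\mathcal{J}_n$; $\varepsilon_{VW}$ is the number of arrows from $V$ to $W$ minus the number from $W$ to $V$. The Fock--Goncharov coordinates are: for $V=v_{\mathbf{x},\mathbf{y},\mathbf{z}}^{m,l,p}\in\mathcal{J}_n$ with $\mathbf{x}\prec\mathbf{y}\prec\mathbf{z}\prec\mathbf{x}$, $$X_V=\frac{\Omega(\mathbf{x}^{m+1}\wedge\mathbf{y}^{l}\wedge\mathbf{z}^{p-1})}{\Omega(\mathbf{x}^{m+1}\wedge\mathbf{y}^{l-1}\wedge\mathbf{z}^{p})}\cdot\frac{\Omega(\mathbf{x}^{m-1}\wedge\mathbf{y}^{l+1}\wedge\mathbf{z}^{p})}{\Omega(\mathbf{x}^{m}\wedge\mathbf{y}^{l+1}\wedge\mathbf{z}^{p-1})}\cdot\frac{\Omega(\mathbf{x}^{m}\wedge\mathbf{y}^{l-1}\wedge\mathbf{z}^{p+1})}{\Omega(\mathbf{x}^{m-1}\wedge\mathbf{y}^{l}\wedge\mathbf{z}^{p+1})};$$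 for $V=v_{\mathbf{x},\mathbf{y},\mathbf{z}}^{m,0,n-m}\in\mathcal{I}_n'$ on the edge $\mathbf{x}\mathbf{z}$ with adjacent anticlockwise triangles $\mathbf{x}\mathbf{y}\mathbf{z}$ and $\mathbf{x}\mathbf{z}\mathbf{t}$, $$X_V=\frac{\Omega(\mathbf{x}^{m}\wedge\mathbf{z}^{n-m-1}\wedge\mathbf{t}_1)\,\Omega(\mathbf{x}^{m-1}\wedge\mathbf{y}_1\wedge\mathbf{z}^{n-m})}{\Omega(\mathbf{x}^{m}\wedge\mathbf{y}_1\wedge\mathbf{z}^{n-m-1})\,\Omega(\mathbf{x}^{m-1}\wedge\mathbf{z}^{n-m}\wedge\mathbf{t}_1)}.$$ They do not depend on the bases and, for each $\mathcal{T}$, form a birational coordinate system on $\mathcal{X}_{\operatorname{PGL}_n,D_k}$. $\mathcal{FX}(\mathcal{T}_n)$ is the fraction ring (field) over $\mathbb{K}$ generated by the $X_V$, $V\in\mathcal{I}_n'\cup\mathcal{J}_n$, with the rank $n$ Fock--Goncharov Poisson bracket $\{X_V,X_W\}_n=\varepsilon_{VW}X_VX_W$, extended by Leibniz's rule. *)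

(* Defs.v *)
From mathcomp Require Import all_boot all_order all_algebra.
From mathcomp Require Import mpoly.

Set Implicit Arguments.
Unset Strict Implicit.
Unset Printing Implicit Defensive.

Import GRing.Theory.

Local Open Scope ring_scope.

(* Marked points are the elements of 'I_k, in anticlockwise order
   0, 1, ..., k.-1; [cyc x y z] is the relation x < y < z < x. *)
Definition cyc (k : nat) (x y z : 'I_k) : bool :=
  [|| (x < y)%N && (y < z)%N, (y < z)%N && (z < x)%N
    | (z < x)%N && (x < y)%N].

Definition crossing (k : nat) (e f : {set 'I_k}) : bool :=
  [exists a, exists b, exists c, exists d,
    [&& e == [set a; c], f == [set b; d], cyc a b c & cyc c d a]].

Definition noncrossing (k : nat) (T : {set {set 'I_k}}) : bool :=
  [forall e in T, (#|e| == 2)%N && [forall f in T, ~~ crossing e f]].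

(* A triangulation is given by the set of all its edges, each edge being the
   set of its two ends. The sides of the polygon cross nothing, so they belong
   to every maximal set. *)
Definition ideal_triangulation (k : nat) (T : {set {set 'I_k}}) : bool :=
  maxset (@noncrossing k) T.

(* All vertices lie on the boundary circle, so three edges of T joining three
   points pairwise always bound a face of T. *)
Definition triangle (k : nat) (T : {set {set 'I_k}}) (x y z : 'I_k) : bool :=
  [&& [set x; y] \in T, [set y; z] \in T & [set x; z] \in T].

(* A vertex of the n-triangulation is encoded by its barycentric coordinates
   (multiplied by n) with respect to all the marked points; the points of a
   common side of two triangles are thereby identified. *)
Definition vert (k : nat) (x y z : 'I_k) (m l p : nat) : {ffun 'I_k -> nat} :=
  [ffun r => m * (r == x) + l * (r == y) + p * (r == z)]%N.

Definition corner (k n : nat) (V : {ffun 'I_k -> nat}) : bool :=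
  [exists r, V r == n].

(* Each triangle is listed once, as x < y < z in 'I_k (which is anticlockwise).
   The set I_n :|: J_n consists of the vertices of the n-triangulation which are
   not vertices of T. *)
Definition narrows (k n : nat) (T : {set {set 'I_k}})
    (V W : {ffun 'I_k -> nat}) : nat :=
  (\sum_(x < k) \sum_(y < k | x < y) \sum_(z < k | (y < z) && triangle T x y z)
   \sum_(a < n.+1) \sum_(b < n.+1)
   \sum_(c < n.+1 | [&& a + b + c == n, V == vert x y z a b c,
                        ~~ corner n V & ~~ corner n W])
     (((0 < c) && (W == vert x y z a.+1 b c.-1))
      + ((0 < a) && (W == vert x y z a.-1 b.+1 c))
      + ((0 < b) && (W == vert x y z a b.-1 c.+1))))%N.

Definition eps (k n : nat) (T : {set {set 'I_k}})
    (V W : {ffun 'I_k -> nat}) : int :=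
  (narrows n T V W)%:Z - (narrows n T W V)%:Z.

(* The function field of the space of k-tuples of bases of K^n: the variable of
   index (r, i, j) is the j-th entry of the i-th basis vector at the marked
   point r. Pullback along the dominant map sending a k-tuple of bases to the
   class of the k-tuple of flags they span embeds in it the field of rational
   functions on the moduli space. *)
Definition conf_field (K : fieldType) (k n : nat) : fieldType :=
  {fraction {mpoly K[#|{: 'I_k * 'I_n * 'I_n}|]}}.

Definition const (K : fieldType) (k n : nat) (c : K) : conf_field K k n :=
  tofrac (c%:MP).

(* [bvec r i] is the first i vectors of the basis at r, i.e. r^i. *)
Definition bvec (K : fieldType) (k n : nat) (r : 'I_k) (i : nat) :
    seq 'rV[conf_field K k n]_n :=
  take i [seq \row_j tofrac 'X_(enum_rank (r, a, j)) | a <- enum 'I_n].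

(* The volume form det of K^n, on the exterior product of n listed vectors. *)
Definition Omega (F : fieldType) (n : nat) (s : seq 'rV[F]_n) : F :=
  \det (\matrix_(i < n) nth 0 s i).

Definition Xtri (K : fieldType) (k n : nat) (x y z : 'I_k) (m l p : nat) :
    conf_field K k n :=
  let D a b c := Omega (bvec K n x a ++ bvec K n y b ++ bvec K n z c) in
  D m.+1 l p.-1 / D m.+1 l.-1 p
  * (D m.-1 l.+1 p / D m l.+1 p.-1)
  * (D m l.-1 p.+1 / D m.-1 l p.+1).

Definition Xedge (K : fieldType) (k n : nat) (x y z t : 'I_k) (m : nat) :
    conf_field K k n :=
  let b := bvec K n in
  (Omega (b x m ++ b z (n - m).-1%N ++ b t 1%N)
   * Omega (b x m.-1 ++ b y 1%N ++ b z (n - m)%N))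
  / (Omega (b x m ++ b y 1%N ++ b z (n - m).-1%N)
     * Omega (b x m.-1 ++ b z (n - m)%N ++ b t 1%N)).

(* [FGcoord T V X]: V is in I'_n or J_n, and X = X_V. The choices made in
   naming x, y, z, t do not affect the value: rotating x, y, z in the first
   formula, or exchanging x with z and y with t in the second one, changes the
   signs of an even number of determinants. *)
Variant FGcoord (K : fieldType) (k n : nat) (T : {set {set 'I_k}}) :
    {ffun 'I_k -> nat} -> conf_field K k n -> Prop :=
| FGcoord_tri (x y z : 'I_k) (m l p : nat) of
    cyc x y z & triangle T x y z
    & (0 < m)%N & (0 < l)%N & (0 < p)%N & (m + l + p = n)%N :
    FGcoord T (vert x y z m l p) (Xtri K n x y z m l p)
| FGcoord_edge (x y z t : 'I_k) (m : nat) of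
    cyc x y z & triangle T x y z & cyc x z t & triangle T x z t
    & (0 < m)%N & (m < n)%N :
    FGcoord T (vert x y z m 0 (n - m)%N) (Xedge K n x y z t m).

(* The subfield over K generated by the coordinates. *)
Inductive FX (K : fieldType) (k n : nat) (T : {set {set 'I_k}}) :
    conf_field K k n -> Prop :=
| FX_const (c : K) : FX T (const k n c)
| FX_coord V X of FGcoord T V X : FX T X
| FX_add f g of FX T f & FX T g : FX T (f + g)
| FX_mul f g of FX T f & FX T g : FX T (f * g)
| FX_inv f of FX T f : FX T f^-1.

(* B restricts to the Fock-Goncharov Poisson bracket on the field FX T. These
   conditions determine the restriction, and they imply the Jacobi identity. *)
Record FGbracket (K : fieldType) (k n : nat) (T : {set {set 'I_k}})
    (B : conf_field K k n -> conf_field K k n -> conf_field K k n) : Prop := {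
  FGbracket_anti : forall f g, FX T f -> FX T g -> B f g = - B g f;
  FGbracket_linear : forall c f g h, FX T f -> FX T g -> FX T h ->
    B (const k n c * f + g) h = const k n c * B f h + B g h;
  FGbracket_leibniz : forall f g h, FX T f -> FX T g -> FX T h ->
    B (f * g) h = f * B g h + B f h * g;
  FGbracket_coord : forall V W X Y, FGcoord T V X -> FGcoord T W Y ->
    B X Y = (eps n T V W)%:~R * X * Y
}.

(* Main.v *)
(* The bracket. On the field of rational functions of k bases of K^n, let v_(r,a)
   be the a-th vector of the basis at the marked point r, and order the pairs
   (r,a) according to r. The swapping biderivation {f,g} is the sum over points
   p, q of sgn(q - p) times the contraction that moves v_q into the slot of v_p in
   f and v_p into the slot of v_q in g. It does not involve any triangulation. For
   two minors O_I, O_J,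
     {O_I, O_J} = sum over p in I, q in J of sgn(q-p) O_I[p->q] O_J[q->p],
   and since the sums over p alone and over q alone are O_I O_J by the exchange
   relation, {O_I, O_J} is a multiple of O_I O_J as soon as
   sgn(q - p) = alpha(p) + beta(q) for p in I \ J and q in J \ I. This happens for
   the minors x^a y^b z^c attached to the vertices of one n-triangulation, and
   gives {X_V, O_J} = -2 [V = J] X_V O_J for every mutable vertex V. As the exponent
   of O_V in X_W is eps_(W,V), {X_V, X_W} = 2 eps_(V,W) X_V X_W. Hence half the
   swapping biderivation restricts to the bracket of every triangulation.

   The field. It remains to see that FX T does not depend on T. Some change of
   frame makes all k flags spanned by vectors with entries in FX T: it is chosen
   so as to make two flags and a line of a first triangle rational. Edge
   coordinates then give the line of the flag at the opposite vertex of the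
   adjacent triangle, and face coordinates give the rest of this flag one
   dimension at a time. The coordinates of any other triangulation are invariant
   ratios of determinants of these vectors, hence lie in FX T. *)
Require Import Defs.
From mathcomp Require Import all_boot all_order all_algebra.
From mathcomp Require Import perm generic_quotient mpoly.
From mathcomp Require Import zify ring.

Set Implicit Arguments.
Unset Strict Implicit.
Unset Printing Implicit Defensive.

Import GRing.Theory.

Local Open Scope ring_scope.

(** * Derivations of fraction fields *)

Definition derivation (R : comNzRingType) (d : R -> R) : Prop :=
  (forall f g, d (f + g) = d f + d g) /\
  (forall f g, d (f * g) = d f * g + f * d g).

Section Derivation.
Variables (R : comNzRingType) (d : R -> R).
Hypothesis der_d : derivation d.

Lemma derD f g : d (f + g) = d f + d g. Proof. by case: der_d. Qed.
Lemma derM f g : d (f * g) = d f * g + f * d g. Proof. by case: der_d. Qed.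

Lemma der0 : d 0 = 0.
Proof. by apply: (addrI (d 0)); rewrite -derD !addr0. Qed.

Lemma derN f : d (- f) = - d f.
Proof. by apply: (addrI (d f)); rewrite -derD !subrr der0. Qed.

Lemma der1 : d 1 = 0.
Proof.
by have := derM 1 1; rewrite !mulr1 mul1r -[X in X = _]addr0 => /addrI.
Qed.

Lemma der_sum I r (P : pred I) F :
  d (\sum_(i <- r | P i) F i) = \sum_(i <- r | P i) d (F i).
Proof. by apply: (big_morph d derD der0). Qed.

Lemma der_sign (b : bool) f : d ((-1) ^+ b * f) = (-1) ^+ b * d f.
Proof. by case: b; rewrite ?mul1r // expr1 !mulN1r derN. Qed.

Lemma der_prod (I : finType) (F : I -> R) :
  d (\prod_i F i) = \sum_j \prod_i (if i == j then d (F i) else F i).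
Proof.
suff H (r : seq I) : uniq r -> d (\prod_(i <- r) F i)
    = \sum_(j <- r) \prod_(i <- r) (if i == j then d (F i) else F i).
  by rewrite H ?index_enum_uniq.
elim: r => [|a r IH] /=; first by rewrite !big_nil der1.
case/andP=> ar ur; rewrite !big_cons derM eqxx IH // mulr_sumr; congr (_ * _ + _).
  by apply: eq_big_seq => i ir; case: eqP => // e; rewrite -e ir in ar.
apply: eq_big_seq => j jr; rewrite big_cons; case: eqP => // e.
by rewrite e jr in ar.
Qed.

Lemma der_det n (A : 'M[R]_n) :
  d (\det A) = \sum_a \det (\matrix_(i, j) if i == a then d (A i j) else A i j).
Proof.
rewrite /determinant der_sum exchange_big /=; apply: eq_bigr => s _.
rewrite der_sign der_prod mulr_sumr; apply: eq_bigr => a _; congr (_ * _).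
by apply: eq_bigr => i _; rewrite mxE; case: eqP.
Qed.

End Derivation.

Section QuotientRule.
Variable F : fieldType.
Implicit Types a b n m : F.

(** The quotient rule takes the same value on two fractions representing one element: the last
    hypothesis is [a * m = n * b] differentiated. *)
Lemma quotient_rule_unique a b n m da db dn dm : b != 0 -> m != 0 ->
  a * m = n * b -> da * m + a * dm = dn * b + n * db ->
  (da * b - a * db) / b ^+ 2 = (dn * m - n * dm) / m ^+ 2.
Proof.
move=> b0 m0 e de; have ea : a = n * b / m by rewrite -e mulfK.
have eda : da = (dn * b + n * db - a * dm) / m by rewrite -de addrK mulfK.
by rewrite eda ea; field; rewrite b0 m0.
Qed.

Lemma quotient_ruleD a b n m da db dn dm : b != 0 -> m != 0 ->
  ((da * m + a * dm + (dn * b + n * db)) * (b * m)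
    - (a * m + n * b) * (db * m + b * dm)) / (b * m) ^+ 2
  = (da * b - a * db) / b ^+ 2 + (dn * m - n * dm) / m ^+ 2.
Proof. by move=> b0 m0; field; rewrite b0 m0. Qed.

Lemma quotient_ruleM a b n m da db dn dm : b != 0 -> m != 0 ->
  ((da * n + a * dn) * (b * m) - a * n * (db * m + b * dm)) / (b * m) ^+ 2
  = (da * b - a * db) / b ^+ 2 * (n / m) + a / b * ((dn * m - n * dm) / m ^+ 2).
Proof. by move=> b0 m0; field; rewrite b0 m0. Qed.

End QuotientRule.

Section FractionDerivation.
Variables (R : idomainType) (d : R -> R).
Hypothesis der_d : derivation d.
Local Notation "x %:F" := (tofrac x).

Lemma pi_frac (r : {ratio R}) :
  \pi_({fraction R})%qT r = (frac r).1%:F / (frac r).2%:F :> {fraction R}.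
Proof.
have rF : (frac r).2%:F != 0 by rewrite tofrac_eq0 denom_ratioP.
apply: (mulIf rF); rewrite divfK //.
unlock tofrac; rewrite -[LHS]FracField.pi_mul; apply/eqmodP.
by rewrite /= FracField.equivfE !numden_Ratio ?mulf_neq0 ?oner_eq0 //= ?mulr1
  ?denom_ratioP // mulrC eqxx.
Qed.

Lemma fraction_repr (x : {fraction R}) :
  exists n m, m != 0 /\ x = n%:F / m%:F.
Proof.
rewrite -[x]reprK pi_frac; eexists; eexists; split; last by [].
exact: denom_ratioP.
Qed.

(** The quotient rule on the representative picked by [repr]; [frac_der_div] removes the dependence
    on this choice. *)
Definition frac_der (x : {fraction R}) : {fraction R} :=
  let n := (frac (repr x)).1 in let m := (frac (repr x)).2 in
  ((d n)%:F * m%:F - n%:F * (d m)%:F) / m%:F ^+ 2.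

Lemma frac_der_div n m : m != 0 ->
  frac_der (n%:F / m%:F) = ((d n)%:F * m%:F - n%:F * (d m)%:F) / m%:F ^+ 2.
Proof.
move=> m0; rewrite /frac_der; set x := n%:F / m%:F.
have := pi_frac (repr x); rewrite reprK.
have := denom_ratioP (repr x); move: (frac (repr x)) => -[a b] /= b0 ex.
have mF : m%:F != 0 by rewrite tofrac_eq0.
have bF : b%:F != 0 by rewrite tofrac_eq0.
have e : a%:F * m%:F = n%:F * b%:F.
  by move/eqP: ex; rewrite eqr_div // => /eqP.
have de : (d a)%:F * m%:F + a%:F * (d m)%:F = (d n)%:F * b%:F + n%:F * (d b)%:F.
  have: a * m = n * b by apply/eqP; rewrite -tofrac_eq !tofracM e.
  move/(congr1 d); rewrite !(derM der_d) => /(congr1 (@tofrac _)).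
  by rewrite !tofracD !tofracM.
exact: quotient_rule_unique.
Qed.

Lemma frac_der_tofrac a : frac_der a%:F = (d a)%:F.
Proof.
have := @frac_der_div a 1 (oner_neq0 _).
by rewrite tofrac1 (der1 der_d) tofrac0 mulr0 subr0 mulr1 expr1n !divr1.
Qed.

Lemma frac_derivation : derivation frac_der.
Proof.
split=> f g; have [a [b [b0 ->]]] := fraction_repr f;
  have [a' [b' [b'0 ->]]] := fraction_repr g;
  have bF : b%:F != 0 by [rewrite tofrac_eq0 | ];
  have bF' : b'%:F != 0 by [rewrite tofrac_eq0 | ].
  rewrite (addf_div _ _ bF bF') -!tofracM -tofracD !frac_der_div ?mulf_neq0 //.
  rewrite (derD der_d) !(derM der_d) !tofracD !tofracM.
  exact: quotient_ruleD.
rewrite mulf_div -!tofracM !frac_der_div ?mulf_neq0 //.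
rewrite !(derM der_d) !tofracD !tofracM.
exact: quotient_ruleM.
Qed.

End FractionDerivation.

(** * The swapping bracket *)

(* [s] lists the first [I r] vectors at each marked point [r]. *)
Definition initial k n (s : seq ('I_k * 'I_n)) (I : 'I_k -> nat) : Prop :=
  [/\ uniq s, size s = n, forall p, (p \in s) = (p.2 < I p.1)%N
    & forall r, (I r <= n)%N].

Definition ord_sign k (r s : 'I_k) : int := (r < s)%N%:Z - (s < r)%N%:Z.

Section SwappingBracket.
Variables (F : fieldType) (k n : nat).
Local Notation point := ('I_k * 'I_n)%type.
Variables (v : point -> 'rV[F]_n) (dp : point -> 'I_n -> F -> F).
Hypothesis der_dp : forall p i, derivation (dp p i).
Hypothesis dp_v : forall p q i j, dp p i (v q 0 j) = ((p == q) && (i == j))%:R.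

(* The second half of Sklyanin's bracket of matrix entries, with signs ordering
   the column indices, is omitted: it is a sum of products with a factor obtained
   from [f] by an element of gl_n, hence vanishes when [f] is GL_n-invariant. *)
Definition swapping (f g : F) : F :=
  \sum_p \sum_q (ord_sign p.1 q.1)%:~R *
    \sum_i \sum_j (v p 0 j * dp p i f) * (v q 0 i * dp q j g).

Lemma swapping_anti f g : swapping f g = - swapping g f.
Proof.
rewrite /swapping exchange_big -sumrN; apply: eq_bigr => p _.
rewrite -sumrN; apply: eq_bigr => q _; rewrite -mulNr -mulrNz.
have -> : (- ord_sign p.1 q.1) = ord_sign q.1 p.1 by rewrite /ord_sign opprB.
congr (_ * _); rewrite exchange_big; apply: eq_bigr => i _.
by apply: eq_bigr => j _; rewrite mulrC.
Qed.

Lemma derivation_swappingl h : derivation (swapping^~ h).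
Proof.
split=> f g; rewrite /swapping.
  rewrite -big_split; apply: eq_bigr => p _; rewrite -big_split.
  apply: eq_bigr => q _ /=; rewrite -mulrDr -big_split; congr (_ * _).
  apply: eq_bigr => i _; rewrite -big_split; apply: eq_bigr => j _.
  by rewrite (derD (der_dp p i)) /=; ring.
rewrite mulr_suml mulr_sumr -big_split; apply: eq_bigr => p _.
rewrite mulr_suml mulr_sumr -big_split; apply: eq_bigr => q _ /=.
rewrite -[X in X + _]mulrA [X in _ + X]mulrCA -mulrDr; congr (_ * _).
rewrite mulr_suml mulr_sumr -big_split; apply: eq_bigr => i _ /=.
rewrite mulr_suml mulr_sumr -big_split; apply: eq_bigr => j _ /=.
by rewrite (derM (der_dp p i)) /=; ring.
Qed.

Definition frame (sigma : 'I_n -> point) : 'M[F]_n := \matrix_i v (sigma i).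

(** The [a]-th differentiated determinant, expanded along row [a], leaves one cofactor. As [sigma]
    may repeat a point, all positions of [p] contribute. *)
Lemma dp_det_frame sigma p i : dp p i (\det (frame sigma)) =
  \sum_(a | sigma a == p) \adj (frame sigma) i a.
Proof.
rewrite (der_det (der_dp p i)) [RHS]big_mkcond; apply: eq_bigr => a _.
rewrite (expand_det_row _ a).
under eq_bigr => j _.
  rewrite !mxE eqxx dp_v.
  rewrite (_ : cofactor _ a j = \adj (frame sigma) j a); last first.
    rewrite mxE /cofactor; congr (_ * \det _); apply/matrixP => b c.
    by rewrite !mxE eq_sym (negPf (neq_lift _ _)).
  over.
case: (sigma a =P p) => [<-|ne].
  rewrite (bigD1 i) //= !eqxx mul1r big1 ?addr0 // => j ji.
  by rewrite eq_sym (negPf ji) andbF mul0r.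
by rewrite big1 // => j _; case: eqP => [e|]; rewrite ?mul0r //; case: ne.
Qed.

(** Entry (a, b) of [frame sigma *m \adj (frame tau)] is the minor of [tau] whose row [b] has been
    replaced by the vector at [sigma a]. The two factors are thus the two minors after an exchange
    of vectors. *)
Lemma swapping_det sigma tau :
  swapping (\det (frame sigma)) (\det (frame tau)) =
  \sum_a \sum_b (ord_sign (sigma a).1 (tau b).1)%:~R *
    ((frame sigma *m \adj (frame tau)) a b
     * (frame tau *m \adj (frame sigma)) b a).
Proof.
rewrite /swapping.
(* The sum over positions is split along the fibres of [sigma] and [tau], to match the sum over
   points in [swapping]. *)
transitivity (\sum_p \sum_q \sum_(a | sigma a == p) \sum_(b | tau b == q)
   (ord_sign (sigma a).1 (tau b).1)%:~R *
    ((frame sigma *m \adj (frame tau)) a b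
     * (frame tau *m \adj (frame sigma)) b a)); last first.
  under eq_bigr => p _ do rewrite exchange_big /=.
  rewrite [RHS](partition_big sigma xpredT) //=; apply: eq_bigr => p _.
  apply: eq_bigr => a _.
  by rewrite [RHS](partition_big tau xpredT).
apply: eq_bigr => p _; apply: eq_bigr => q _.
rewrite mulr_sumr.
under eq_bigr => i _.
  rewrite mulr_sumr.
  under eq_bigr => j _.
    rewrite !dp_det_frame !mulr_sumr.
    under eq_bigr => b tb.
      rewrite mulr_suml mulr_sumr.
      over.
    over.
  rewrite exchange_big.
  under eq_bigr => b _ do rewrite exchange_big /=.
  rewrite exchange_big; over.
rewrite exchange_big; apply: eq_bigr => a /eqP ea.
rewrite exchange_big; apply: eq_bigr => b /eqP eb /=.
rewrite -ea -eb.
under eq_bigr => i _ do rewrite -mulr_sumr.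
rewrite -mulr_sumr; congr (_ * _).
rewrite [in RHS]mulrC !mxE mulr_suml; apply: eq_bigr => i _.
rewrite mulr_sumr; apply: eq_bigr => j _; rewrite !mxE.
by ring.
Qed.

(** The vector at [sigma a] already stands in row [b0] of [frame tau], so putting it in another row
    makes two rows equal. *)
Lemma frame_adj_out sigma tau a b0 : sigma a = tau b0 ->
  forall b, b != b0 -> (frame sigma *m \adj (frame tau)) a b = 0.
Proof.
move=> e b bb0.
have -> : (frame sigma *m \adj (frame tau)) a b
        = (frame tau *m \adj (frame tau)) b0 b.
  by rewrite !mxE; apply: eq_bigr => j _; rewrite !mxE e.
by rewrite mul_mx_adj mxE eq_sym (negPf bb0).
Qed.

(* [C a b * C' b a] has all its row and column sums equal to the product of the
   determinants, and its rows and columns at the common points of [sigma] and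
   [tau] have a single nonzero entry. *)
Lemma swapping_det_sign sigma tau (alpha beta : 'I_n -> int) :
  (forall a b, sigma a = tau b -> alpha a + beta b = 0) ->
  (forall a b, sigma a \notin codom tau -> tau b \notin codom sigma ->
     ord_sign (sigma a).1 (tau b).1 = alpha a + beta b) ->
  swapping (\det (frame sigma)) (\det (frame tau)) =
  (\sum_a alpha a + \sum_b beta b)%:~R
    * \det (frame sigma) * \det (frame tau).
Proof.
move=> h0 h1; rewrite swapping_det.
pose C a b := (frame sigma *m \adj (frame tau)) a b.
pose C' b a := (frame tau *m \adj (frame sigma)) b a.
(* The sign can be replaced by [alpha a + beta b] in every term: both vanish if the two points
   coincide, one of the exchanged minors vanishes if they differ and one of them is common to both
   lists, and [h1] covers the rest. *)
transitivity (\sum_a \sum_b (alpha a + beta b)%:~R * (C a b * C' b a)).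
  apply: eq_bigr => a _; apply: eq_bigr => b _; rewrite -/(C a b) -/(C' b a).
  have [e|ne] := sigma a =P tau b.
    by rewrite h0 // e /ord_sign subrr.
  have [/codomP[b0 e]|na] := boolP (sigma a \in codom tau).
    rewrite [C a b](frame_adj_out e) ?mul0r ?mulr0 //.
    by apply: contra_not_neq ne => ->.
  have [/codomP[a0 e]|nb] := boolP (tau b \in codom sigma).
    rewrite [C' b a](frame_adj_out e) ?mulr0 //.
    by apply: contra_not_neq ne => ->.
  by rewrite h1.
(* The exchange relation: this product is scalar, and its diagonal entries are the row sums of
   [C a b * C' b a]. With the two frames exchanged it gives the column sums. *)
have adj4 (A B : 'M[F]_n) :
    (A *m \adj B) *m (B *m \adj A) = (\det B * \det A)%:M.
  rewrite mulmxA -(mulmxA A) mul_adj_mx mul_mx_scalar -scalemxAl mul_mx_adj.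
  by rewrite scale_scalar_mx.
have KC a : \sum_b C a b * C' b a = \det (frame tau) * \det (frame sigma).
  have := congr1 (fun M : 'M_n => M a a) (adj4 (frame sigma) (frame tau)).
  by rewrite [RHS]mxE eqxx mulr1n mxE.
have KC' b : \sum_a C a b * C' b a = \det (frame tau) * \det (frame sigma).
  have := congr1 (fun M : 'M_n => M b b) (adj4 (frame tau) (frame sigma)).
  rewrite [RHS]mxE eqxx mulr1n mxE mulrC => <-.
  by apply: eq_bigr => a _; rewrite mulrC.
under eq_bigr => a _.
  under eq_bigr => b _ do rewrite rmorphD mulrDl.
  rewrite big_split /= -mulr_sumr KC; over.
rewrite big_split /= -mulr_suml [in X in _ + X]exchange_big /=.
under [in X in _ + X]eq_bigr => b _ do rewrite -mulr_sumr KC'.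
rewrite -mulr_suml -mulrDl -!rmorph_sum -rmorphD /= -mulrA; congr (_ * _).
by rewrite mulrC.
Qed.

(** At each [r] both lists hold initial segments of the basis, so the points of [s] outside [t] are
    those with index from [J r] up to [I r]; truncated subtraction counts them. *)
Lemma sum_initialD (s t : seq point) I J (alpha : 'I_k -> int) :
  initial s I -> initial t J ->
  \sum_(p <- s | p \notin t) alpha p.1 = \sum_r alpha r * (I r - J r)%N%:Z.
Proof.
move=> [us _ sI In] [_ _ tJ _].
rewrite big_mkcond big_uniq //= -big_mkcondr /=.
rewrite (eq_bigl (fun p : point => J p.1 <= p.2 < I p.1)%N); last first.
  by move=> p; rewrite sI tJ -leqNgt andbC.
rewrite -(pair_big_dep xpredT (fun r (i : 'I_n) => J r <= i < I r)%N (fun r i => alpha r)).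
apply: eq_bigr => r _ /=; rewrite sumr_const -mulr_natr; congr (_ * _).
rewrite natz; congr Posz; rewrite -sum1_card.
rewrite -(big_ord_widen_cond n (fun i => J r <= i)%N (fun _ => 1%N)) //.
rewrite big_mkcond -(big_mkord xpredT (fun i => if (J r <= i)%N then 1 else 0)%N) /=.
have [le|lt] := leqP (J r) (I r); last first.
  rewrite big1_seq; last by move=> i; rewrite mem_index_iota; case: ifP => //; lia.
  lia.
rewrite (@big_cat_nat _ _ _ (J r)) //= big1_seq; last first.
  by move=> i; rewrite mem_index_iota; case: ifP => //; lia.
rewrite add0n (eq_big_nat _ _ (F2 := fun _ => 1%N)); last by move=> i /andP[->].
by rewrite sum_nat_const_nat muln1.
Qed.

(** For initial segments the sign condition of [swapping_det_sign] becomes one on marked points: [s]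
    has a vector outside [t] at [r] only if [J r < I r]. *)
Lemma swapping_initial (s t : seq point) I J (alpha beta : 'I_k -> int) :
  initial s I -> initial t J ->
  (forall r q, (J r < I r)%N -> (I q < J q)%N ->
     ord_sign r q = alpha r + beta q) ->
  swapping (Omega (map v s)) (Omega (map v t)) =
  (\sum_r alpha r * (I r - J r)%N%:Z + \sum_r beta r * (J r - I r)%N%:Z)%:~R
    * Omega (map v s) * Omega (map v t).
Proof.
move=> sI tJ h; have [us sn s_in _] := sI; have [ut tn t_in _] := tJ.
have OE u (un : size u = n) :
    Omega (map v u) = \det (frame (tnth (Tuple (introT eqP un)))).
  congr (\det _); apply/row_matrixP => i; rewrite !rowK.
  have p0 := tnth (Tuple (introT eqP un)) i.
  by rewrite (nth_map p0) ?un // (tnth_nth p0).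
have codE (u : seq point) (un : size u = n) : codom (tnth (Tuple (introT eqP un))) =i u.
  by move=> p; rewrite codomE map_tnth_enum.
have sumE u (un : size u = n) (g : point -> int) :
    \sum_(p <- u) g p = \sum_a g (tnth (Tuple (introT eqP un)) a).
  have E := map_tnth_enum (Tuple (introT eqP un)).
  by rewrite -[in LHS](E : _ = u) big_map big_enum.
rewrite (OE s sn) (OE t tn).
set sg := tnth _; set ta := tnth _.
(* The weights are set to zero at the common points, as the first condition of [swapping_det_sign]
   demands. *)
pose al a := if sg a \in t then 0 else alpha (sg a).1.
pose be b := if ta b \in s then 0 else beta (ta b).1.
have -> : \sum_r alpha r * (I r - J r)%N%:Z = \sum_a al a.
  rewrite -(sum_initialD alpha sI tJ) big_mkcond (sumE s sn).
  by apply: eq_bigr => a _; rewrite /al if_neg.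
have -> : \sum_r beta r * (J r - I r)%N%:Z = \sum_b be b.
  rewrite -(sum_initialD beta tJ sI) big_mkcond (sumE t tn).
  by apply: eq_bigr => a _; rewrite /be if_neg.
apply: swapping_det_sign => a b.
  move=> e; rewrite /al /be e.
  have ->: ta b \in t by rewrite -(codE t tn) codom_f.
  by rewrite -e -(codE s sn) codom_f.
rewrite !codE => na nb; rewrite /al /be (negPf na) (negPf nb).
have sa : sg a \in s by rewrite -(codE s sn) codom_f.
have tb : ta b \in t by rewrite -(codE t tn) codom_f.
apply: h; move: na nb sa tb; rewrite !s_in !t_in; lia.
Qed.

End SwappingBracket.

(** * Log-canonical pairs of minors *)

Definition block k n (r : 'I_k) (a : nat) : seq ('I_k * 'I_n) :=
  take a [seq (r, i) | i <- enum 'I_n].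

Lemma mem_block k n (r : 'I_k) a p :
  (p \in block n r a) = (p.1 == r) && (p.2 < a)%N.
Proof.
rewrite /block -map_take; case: p => r' i /=.
have mem_take : (i \in take a (enum 'I_n)) = (i < a)%N.
  rewrite -(mem_map (@ord_inj n)) map_take val_enum_ord.
  by rewrite take_iota mem_iota add0n leq0n leq_min ltn_ord andbT.
apply/mapP/andP => [[j]|[/eqP -> ia]]; last by exists i; rewrite ?mem_take.
by rewrite -mem_take => ? [-> ->].
Qed.

Lemma size_block k n (r : 'I_k) a : (a <= n)%N -> size (block n r a) = a.
Proof. by move=> an; rewrite size_takel // size_map -cardE card_ord. Qed.

Lemma uniq_block k n (r : 'I_k) a : uniq (block n r a).
Proof. by rewrite take_uniq // map_inj_uniq ?enum_uniq // => ? ? []. Qed.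

Lemma vert_out k (x y z : 'I_k) a b c r :
  r \notin [:: x; y; z] -> vert x y z a b c r = 0%N.
Proof.
by rewrite !inE !negb_or ffunE => /and3P[/negPf -> /negPf -> /negPf ->]; rewrite !muln0.
Qed.

Section Blocks.
Variables (k n : nat) (x y z : 'I_k).
Hypothesis xyz : uniq [:: x; y; z].

Lemma vert_val a b c : (vert x y z a b c x = a) * (vert x y z a b c y = b)
  * (vert x y z a b c z = c).
Proof.
rewrite !ffunE !eqxx; move: xyz; rewrite /= !inE negb_or !(eq_sym z) !(eq_sym y x).
by case/and3P=> /andP[/negPf -> /negPf ->] /negPf -> _; (split; first split); lia.
Qed.

Lemma initial_blocks a b c : (a + b + c = n)%N ->
  initial (block n x a ++ block n y b ++ block n z c) (vert x y z a b c).
Proof.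
move=> abc; split.
- rewrite !cat_uniq !uniq_block /= andbT !has_cat !negb_or.
  have dis r s i j : r != s -> ~~ has (mem (block n r i)) (block n s j).
    move=> rs; apply/hasPn => p; rewrite /= !mem_block => /andP[/eqP -> _].
    by rewrite eq_sym (negPf rs).
  by move: xyz; rewrite /= !inE negb_or => /and3P[/andP[xy xz] yz _]; rewrite !dis.
- by rewrite !size_cat !size_block; lia.
- move=> [r i] /=; rewrite !mem_cat !mem_block /=.
  have [rin|rout] := boolP (r \in [:: x; y; z]); last first.
    rewrite vert_out //; move: rout; rewrite !inE !negb_or.
    by case/and3P=> /negPf -> /negPf -> /negPf ->.
  move: xyz; rewrite /= !inE negb_or => /and3P[/andP[xy xz] yz _].
  move: rin; rewrite !inE => /or3P[] /eqP ->; rewrite !vert_val !eqxx.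
  + by rewrite (negPf xy) (negPf xz) !orbF.
  + by rewrite (eq_sym y x) (negPf xy) (negPf yz) orbF.
  + by rewrite (eq_sym z x) (negPf xz) (eq_sym z y) (negPf yz).
- move=> r; have [rin|rout] := boolP (r \in [:: x; y; z]); last by rewrite vert_out.
  by move: rin; rewrite !inE => /or3P[] /eqP ->; rewrite !vert_val; lia.
Qed.

End Blocks.

Lemma big_support (k : nat) (l : seq 'I_k) (G : 'I_k -> int) : uniq l ->
  (forall r, r \notin l -> G r = 0) -> \sum_r G r = \sum_(r <- l) G r.
Proof.
move=> ul G0; rewrite [RHS]big_uniq //= [RHS]big_mkcond /=; apply: eq_bigr => r _.
by case: ifPn => // /G0.
Qed.

Section LogCanonical.
Variables (F : fieldType) (k n : nat).
Local Notation point := ('I_k * 'I_n)%type.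
Variables (v : point -> 'rV[F]_n) (dp : point -> 'I_n -> F -> F).
Hypothesis der_dp : forall p i, derivation (dp p i).
Hypothesis dp_v : forall p q i j, dp p i (v q 0 j) = ((p == q) && (i == j))%:R.
Local Notation O s := (Omega (map v s)).

Definition log_canonical (f g : F) (c : int) : Prop :=
  swapping v dp f g = c%:~R * f * g.

Lemma log_canonical_mull f f' g c c' :
  log_canonical f g c -> log_canonical f' g c' -> log_canonical (f * f') g (c + c').
Proof.
rewrite /log_canonical => e e'.
by rewrite (derM (derivation_swappingl _ der_dp g)) /= e e' rmorphD /=; ring.
Qed.

(** Obtained by applying the derivation to [f * f^-1 = 1]. *)
Lemma log_canonical_invl f g c :
  f != 0 -> log_canonical f g c -> log_canonical f^-1 g (- c).
Proof.
rewrite /log_canonical => f0 e; apply: (mulfI f0).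
have := derM (derivation_swappingl v der_dp g) f f^-1.
rewrite mulfV // (der1 (derivation_swappingl v der_dp g)) /= e => /eqP.
rewrite eq_sym addr_eq0 eq_sym eqr_oppLR => /eqP ->.
by rewrite rmorphN /=; field.
Qed.

Lemma log_canonical_divl f f' g c c' : f' != 0 ->
  log_canonical f g c -> log_canonical f' g c' -> log_canonical (f / f') g (c - c').
Proof. by move=> f0 e e'; apply: log_canonical_mull => //; apply: log_canonical_invl. Qed.

Lemma log_canonical_anti f g c : log_canonical f g c -> log_canonical g f (- c).
Proof.
rewrite /log_canonical swapping_anti => e; rewrite -[LHS]opprK e rmorphN /=; ring.
Qed.

Definition before (b r : 'I_k) : int := (r < b)%N%:Z.
(* The sign for the linear order on the marked points starting at [b]. It differs
   from [ord_sign] by a function of [r] plus a function of [s]. *)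
Definition rot_sign (b r s : 'I_k) : int :=
  ord_sign r s + (before b s - before b r) *+ 2.

(** Any marked point [b] may serve as origin of the linear order. Returning to [ord_sign] shifts
    [alpha] and [beta] by opposite multiples of [before b], and the shifts add up to the last sum,
    linear in the difference of [I] and [J]. *)
Lemma log_canonical_initial b (s t : seq point) I J (alpha beta : 'I_k -> int) :
  initial s I -> initial t J ->
  (forall r q, (J r < I r)%N -> (I q < J q)%N ->
     rot_sign b r q = alpha r + beta q) ->
  log_canonical (O s) (O t)
   (\sum_r alpha r * (I r - J r)%N%:Z + \sum_r beta r * (J r - I r)%N%:Z
    + \sum_r (before b r *+ 2) * ((I r)%:Z - (J r)%:Z)).
Proof.
move=> sI tJ h; rewrite /log_canonical.
rewrite (@swapping_initial _ _ _ _ _ der_dp dp_v _ _ I J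
   (fun r => alpha r + before b r *+ 2) (fun r => beta r - before b r *+ 2)) //; last first.
  by move=> r q /h H /H e; move: e; rewrite /rot_sign; lia.
congr (_%:~R * _ * _); rewrite -!big_split; apply: eq_bigr => r _ /=.
have -> : (I r)%:Z - (J r)%:Z = (I r - J r)%N%:Z - (J r - I r)%N%:Z by lia.
by ring.
Qed.

End LogCanonical.

Lemma ord_eqE k (r s : 'I_k) : (r == s) = (r == s :> nat).
Proof. by []. Qed.

Lemma cyc_uniq k (x y z : 'I_k) : cyc x y z -> uniq [:: x; y; z].
Proof. by rewrite /cyc /= !inE !ord_eqE; lia. Qed.

Lemma cyc_rot k (x y z : 'I_k) : cyc x y z -> cyc y z x.
Proof. by rewrite /cyc; lia. Qed.

Lemma vert_rot k (x y z : 'I_k) a b c : vert x y z a b c = vert y z x b c a.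
Proof. by apply/ffunP => r; rewrite !ffunE -addnA addnC. Qed.

Section CoordinateMinors.
Variables (F : fieldType) (k n : nat).
Local Notation point := ('I_k * 'I_n)%type.
Variables (v : point -> 'rV[F]_n) (dp : point -> 'I_n -> F -> F).
Hypothesis der_dp : forall p i, derivation (dp p i).
Hypothesis dp_v : forall p q i j, dp p i (v q 0 j) = ((p == q) && (i == j))%:R.
Hypothesis Omega_neq0 : forall s, uniq s -> size s = n -> Omega (map v s) != 0.
Local Notation O s := (Omega (map v s)).
Local Notation log_canonical := (log_canonical v dp).
Local Notation D x y z a b c := (O (block n x a ++ block n y b ++ block n z c)).

Lemma Omega_initial_neq0 s I : initial s I -> O s != 0.
Proof. by case=> us sn _ _; exact: Omega_neq0. Qed.

Definition face_coord (x y z : 'I_k) m l p : F :=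
  D x y z m.+1 l p.-1 / D x y z m.+1 l.-1 p
  * (D x y z m.-1 l.+1 p / D x y z m l.+1 p.-1)
  * (D x y z m l.-1 p.+1 / D x y z m.-1 l p.+1).

Definition edge_coord (x y z t : 'I_k) m : F :=
  (D x z t m (n - m).-1 1 * D x y z m.-1 1 (n - m))
  / (D x y z m 1 (n - m).-1 * D x z t m.-1 (n - m) 1).

Lemma log_canonical_face x y z m l p g (c : nat -> nat -> nat -> int) :
  uniq [:: x; y; z] -> (0 < m)%N -> (0 < l)%N -> (0 < p)%N -> (m + l + p = n)%N ->
  (forall i j h, (i + j + h = n)%N -> log_canonical (D x y z i j h) g (c i j h)) ->
  log_canonical (face_coord x y z m l p) g
    (c m.+1 l p.-1 - c m.+1 l.-1 p + (c m.-1 l.+1 p - c m l.+1 p.-1)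
     + (c m l.-1 p.+1 - c m.-1 l p.+1)).
Proof.
move=> u m0 l0 p0 mlp h.
have hD a b d a' b' d' : (a + b + d = n)%N -> (a' + b' + d' = n)%N ->
    log_canonical (D x y z a b d / D x y z a' b' d') g (c a b d - c a' b' d').
  move=> e e'; apply: (log_canonical_divl der_dp); [|exact: h|exact: h].
  exact: Omega_initial_neq0 (initial_blocks u e').
apply: (log_canonical_mull der_dp); last by apply: hD; lia.
by apply: (log_canonical_mull der_dp); apply: hD; lia.
Qed.

Lemma log_canonical_edge x y z t m g c1 c2 c3 c4 :
  uniq [:: x; y; z] -> uniq [:: x; z; t] -> (0 < m)%N -> (m < n)%N ->
  log_canonical (D x z t m (n - m).-1 1) g c1 ->
  log_canonical (D x y z m.-1 1 (n - m)) g c2 ->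
  log_canonical (D x y z m 1 (n - m).-1) g c3 ->
  log_canonical (D x z t m.-1 (n - m) 1) g c4 ->
  log_canonical (edge_coord x y z t m) g ((c1 + c2) - (c3 + c4)).
Proof.
move=> u u' m0 mn h1 h2 h3 h4.
apply: (log_canonical_divl der_dp).
- by rewrite mulf_neq0 //; apply: Omega_initial_neq0; apply: initial_blocks => //; lia.
- exact: (log_canonical_mull der_dp).
- exact: (log_canonical_mull der_dp).
Qed.

Lemma log_canonical_eq f g c c' :
  log_canonical f g c -> c = c' -> log_canonical f g c'.
Proof. by move=> h <-. Qed.

Section Target.
Variables (t : seq point) (J : 'I_k -> nat).
Hypothesis tJ : initial t J.

(** In the order starting at [x], a source point is either [x], before all other points of the arc,
    or lies at [y] or later; so the sign depends on the source point alone. The coefficient is then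
    a constant plus a function of each [I r] separately, and such coefficients cancel in the
    coordinates. *)
Lemma log_canonical_arc x y : x != y ->
  (forall r, (0 < J r)%N -> [|| r == x, r == y | cyc x r y]) ->
  exists C H, (forall r, H r 0%N = 0) /\ forall s I, initial s I ->
    (forall r, (0 < I r)%N -> ~~ cyc x r y) ->
    log_canonical (O s) (O t) (C + \sum_r H r (I r)).
Proof.
move=> xy Jxy.
exists (- \sum_r (before x r *+ 2) * (J r)%:Z).
exists (fun r i => (if r == x then 1 else -1) * (i - J r)%N%:Z + (before x r *+ 2) * i%:Z).
split=> [r|s I sI Iout]; first by rewrite sub0n !mulr0.
have := @log_canonical_initial _ _ _ v dp der_dp dp_v x s t I J
  (fun r => if r == x then 1 else -1) (fun=> 0) sI tJ.
rewrite [X in _ + X + _]big1 ?addr0; last by move=> r _; rewrite mul0r.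
move=> H; have {H} := H _.
rewrite (_ : _ + _ = - (\sum_r (before x r *+ 2) * (J r)%:Z) + \sum_r
  ((if r == x then 1 else -1) * (I r - J r)%N%:Z + (before x r *+ 2) * (I r)%:Z)).
  apply=> r q Jr Iq.
  have {Jxy} := Jxy q (leq_ltn_trans (leq0n _) Iq).
  have {Iout} := Iout r (leq_ltn_trans (leq0n _) Jr).
  have : r <> q :> nat by move/val_inj => e; move: Iq Jr; rewrite e; lia.
  move: xy; rewrite /cyc /rot_sign /before /ord_sign !ord_eqE.
  by case: (nat_of_ord r =P x); rewrite ?mulr2n; lia.
rewrite -sumrN -!big_split; apply: eq_bigr => r _ /=; ring.
Qed.

Lemma sum_vert (x y z : 'I_k) (H : 'I_k -> nat -> int) a b c :
  uniq [:: x; y; z] -> (forall r, H r 0%N = 0) ->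
  \sum_r H r (vert x y z a b c r) = H x a + H y b + H z c.
Proof.
move=> u H0; rewrite (big_support u) => [|r rn]; last by rewrite vert_out.
by rewrite !big_cons big_nil !vert_val // addr0 addrA.
Qed.

(** Each exponent of each flag occurs equally often in the numerators and in the denominators of a
    face coordinate, so additive coefficients cancel. *)
Lemma face_additive x y z m l p C H :
  uniq [:: x; y; z] -> (0 < m)%N -> (0 < l)%N -> (0 < p)%N -> (m + l + p = n)%N ->
  (forall r, H r 0%N = 0) ->
  (forall s I, initial s I -> (forall r, (0 < I r)%N -> r \in [:: x; y; z]) ->
    log_canonical (O s) (O t) (C + \sum_r H r (I r))) ->
  log_canonical (face_coord x y z m l p) (O t) 0.
Proof.
move=> u m0 l0 p0 mlp H0 h.
pose c a b d := C + (H x a + H y b + H z d).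
apply: log_canonical_eq (log_canonical_face (c := c) u m0 l0 p0 mlp _) _.
  move=> a b d abd; rewrite /c -(sum_vert _ _ _ u H0); apply: h.
    exact: initial_blocks.
  by move=> r; apply: contraTT => /vert_out ->.
by rewrite /c; ring.
Qed.

(** The same cancellation in the edge coordinate, whose four minors involve two different
    triangles. *)
Lemma edge_additive x y z w m C H :
  uniq [:: x; y; z] -> uniq [:: x; z; w] -> (0 < m)%N -> (m < n)%N ->
  (forall r, H r 0%N = 0) ->
  (forall s I, initial s I -> (forall r, (0 < I r)%N -> r \in [:: x; y; z; w]) ->
    log_canonical (O s) (O t) (C + \sum_r H r (I r))) ->
  log_canonical (edge_coord x y z w m) (O t) 0.
Proof.
move=> u u' m0 mn H0 h.
have hy a b c : (a + b + c = n)%N ->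
    log_canonical (D x y z a b c) (O t) (C + (H x a + H y b + H z c)).
  move=> abc; rewrite -(sum_vert _ _ _ u H0); apply: h.
    exact: initial_blocks.
  move=> r; apply: contraTT; rewrite !inE => rn.
  by rewrite vert_out // !inE; apply: contra rn => /or3P[] ->; rewrite ?orbT.
have hw a b c : (a + b + c = n)%N ->
    log_canonical (D x z w a b c) (O t) (C + (H x a + H z b + H w c)).
  move=> abc; rewrite -(sum_vert _ _ _ u' H0); apply: h.
    exact: initial_blocks.
  move=> r; apply: contraTT; rewrite !inE => rn.
  by rewrite vert_out // !inE; apply: contra rn => /or3P[] ->; rewrite ?orbT.
apply: log_canonical_eq (log_canonical_edge u u' m0 mn
  (hw _ _ _ _) (hy _ _ _ _) (hy _ _ _ _) (hw _ _ _ _)) _; lia.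
Qed.

End Target.
End CoordinateMinors.

(** * Brackets of coordinates with minors *)

Section TriangleMinors.
Variables (F : fieldType) (k n : nat).
Local Notation point := ('I_k * 'I_n)%type.
Variables (v : point -> 'rV[F]_n) (dp : point -> 'I_n -> F -> F).
Hypothesis der_dp : forall p i, derivation (dp p i).
Hypothesis dp_v : forall p q i j, dp p i (v q 0 j) = ((p == q) && (i == j))%:R.
Local Notation O s := (Omega (map v s)).
Local Notation log_canonical := (log_canonical v dp).
Variables (t : seq point) (x y z : 'I_k).
Hypothesis xyz : cyc x y z.

Section Triangle.
Variable J : 'I_k -> nat.
Hypothesis tJ : initial t J.
Hypothesis Jxyz : forall r, r \notin [:: x; y; z] -> J r = 0%N.

Let L r i : int := (before x r *+ 2) * (i%:Z - (J r)%:Z).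

(** With no vector to exchange at [y], a source point other than [x] comes at [z] or later in the
    order starting at [x]. Points between [z] and [x] are allowed so as to include the minors at the
    fourth vertex of an edge coordinate. *)
Lemma log_canonical_triangle_le s (I : 'I_k -> nat) : initial s I ->
  (forall r, (0 < I r)%N -> (r \in [:: x; y; z]) || cyc x z r) ->
  (I y <= J y)%N ->
  log_canonical (O s) (O t) (\sum_r
    ((if r == x then 1 else -1) * (I r - J r)%N%:Z + L r (I r))).
Proof.
move=> sI Ixyz Iy.
apply: log_canonical_eq (log_canonical_initial der_dp dp_v (b := x)
  (alpha := fun r => if r == x then 1 else -1) (beta := fun=> 0) sI tJ _) _; last first.
  rewrite [X in _ + X + _]big1 ?addr0 -?big_split //= => r _; exact: mul0r.
move=> r q Jr Iq.
have Jq : q \in [:: x; y; z] by apply: contraTT Iq => /Jxyz ->.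
have {Ixyz} := Ixyz r (leq_ltn_trans (leq0n _) Jr).
have rq : r <> q :> nat by move/val_inj => e; move: Iq Jr; rewrite e; lia.
have ry : r <> y :> nat by move/val_inj => e; move: Jr Iy; rewrite e; lia.
move: Jq xyz rq ry; rewrite /cyc /rot_sign /before /ord_sign !inE !ord_eqE.
by case: (nat_of_ord r =P x); rewrite ?mulr2n; lia.
Qed.

Lemma log_canonical_triangle_ge s (I : 'I_k -> nat) : initial s I ->
  (forall r, (0 < I r)%N -> r \in [:: x; y; z]) -> (J y <= I y)%N ->
  log_canonical (O s) (O t) (\sum_r
    ((if r == x then -1 else 1) * (J r - I r)%N%:Z + L r (I r))).
Proof.
move=> sI Ixyz Iy.
apply: log_canonical_eq (log_canonical_initial der_dp dp_v (b := x)
  (alpha := fun=> 0) (beta := fun r => if r == x then -1 else 1) sI tJ _) _; last first.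
  rewrite [X in X + _ + _]big1 ?add0r -?big_split //= => r _; exact: mul0r.
move=> r q Jr Iq.
have Jq : q \in [:: x; y; z] by apply: contraTT Iq => /Jxyz ->.
have {Ixyz} := Ixyz r (leq_ltn_trans (leq0n _) Jr).
have rq : r <> q :> nat by move/val_inj => e; move: Iq Jr; rewrite e; lia.
have ry : q <> y :> nat by move/val_inj => e; move: Iq Iy; rewrite e; lia.
move: Jq xyz rq ry; rewrite /cyc /rot_sign /before /ord_sign !inE !ord_eqE.
by case: (nat_of_ord q =P x); rewrite ?mulr2n; lia.
Qed.

(* For p in I \ J and q in J \ I, the sign of q - p depends only on p if I y <= J y
   (p lies then at x or z), and only on q otherwise. *)
Definition triangle_form (jx jy jz a b c : nat) : int :=
  if (b <= jy)%N then (a - jx)%N%:Z - (c - jz)%N%:Z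
  else (jz - c)%N%:Z - (jx - a)%N%:Z.

Lemma log_canonical_triangle s a b c : initial s (vert x y z a b c) ->
  log_canonical (O s) (O t)
    (triangle_form (J x) (J y) (J z) a b c + (L x a + L y b + L z c)).
Proof.
move=> sI; have u := cyc_uniq xyz.
have Ixyz r : (0 < vert x y z a b c r)%N -> r \in [:: x; y; z].
  by apply: contraTT => /vert_out ->.
have yx : y == x = false by apply/negP; move: xyz; rewrite /cyc ord_eqE; lia.
have zx : z == x = false by apply/negP; move: xyz; rewrite /cyc ord_eqE; lia.
rewrite /triangle_form; case: leqP => h.
  apply: log_canonical_eq (log_canonical_triangle_le sI _ _) _.
  - by move=> r /Ixyz ->.
  - by rewrite vert_val.
  rewrite (big_support u) => [|r rn]; last first.
    by rewrite /L vert_out // Jxyz // subrr !mulr0.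
  rewrite !big_cons big_nil !vert_val // eqxx yx zx.
  by move: (L x a) (L y b) (L z c); lia.
apply: log_canonical_eq (log_canonical_triangle_ge sI Ixyz _) _.
  by rewrite vert_val // ltnW.
rewrite (big_support u) => [|r rn]; last first.
  by rewrite /L vert_out // Jxyz // subrr !mulr0.
rewrite !big_cons big_nil !vert_val // eqxx yx zx.
by move: (L x a) (L y b) (L z c); lia.
Qed.

(** The exponent at [y] is zero, so the first branch always applies; the constant -1 comes from the
    single vector at [w], which lies after all target points. *)
Lemma log_canonical_triangle_edge s w a c : cyc x z w ->
  initial s (vert x z w a c 1) ->
  log_canonical (O s) (O t)
    ((a - J x)%N%:Z - (c - J z)%N%:Z - 1 + (L x a + L y 0 + L z c + L w 1)).
Proof.
move=> xzw sI; have u := cyc_uniq xzw.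
have Ixyz r : (0 < vert x z w a c 1 r)%N -> r \in [:: x; z; w].
  by apply: contraTT => /vert_out ->.
have u4 : uniq [:: x; y; z; w].
  by move: xyz xzw; rewrite /cyc /= !inE !ord_eqE; lia.
have yn : y \notin [:: x; z; w].
  by move: u4; rewrite /= !inE !ord_eqE; lia.
have wn : w \notin [:: x; y; z].
  by move: u4; rewrite /= !inE !ord_eqE; lia.
have yx : y == x = false by apply/negP; move: xyz; rewrite /cyc ord_eqE; lia.
have zx : z == x = false by apply/negP; move: xyz; rewrite /cyc ord_eqE; lia.
have wx : w == x = false by apply/negP; move: xzw; rewrite /cyc ord_eqE; lia.
apply: log_canonical_eq (log_canonical_triangle_le sI _ _) _.
- move=> r /Ixyz; rewrite !inE => /or3P[] /eqP ->; rewrite ?eqxx ?orbT //.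
  by rewrite xzw orbT.
- by rewrite vert_out.
rewrite (big_support u4) => [|r rn]; last first.
  rewrite /L vert_out ?Jxyz ?subrr ?mulr0 //; apply: contra rn; rewrite !inE;
  by case/or3P=> ->; rewrite ?orbT.
rewrite !big_cons big_nil !vert_val // (vert_out _ _ _ yn) (Jxyz wn).
rewrite eqxx yx zx wx.
by move: (L x a) (L y 0%N) (L z c) (L w 1%N); lia.
Qed.

End Triangle.
End TriangleMinors.

(** Each branch of [triangle_form] is a function of [a] plus a function of [c], which cancels around
    the hexagon, and the branches agree on the line [b = jy]. So only [l = jy] contributes, through
    minus the second difference of |a - jx|, which is -2 at [m = jx] and 0 elsewhere. *)
Lemma triangle_form_face (jx jy jz m l p : nat) :
  (0 < m)%N -> (0 < l)%N -> (0 < p)%N -> (m + l + p = jx + jy + jz)%N ->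
  let c := triangle_form jx jy jz in
  c m.+1 l p.-1 - c m.+1 l.-1 p + (c m.-1 l.+1 p - c m l.+1 p.-1)
     + (c m l.-1 p.+1 - c m.-1 l p.+1)
  = (if (m == jx) && (l == jy) then -2 else 0).
Proof.
move=> m0 l0 p0 e /=; rewrite /triangle_form.
have [lt|gt|eq] := ltngtP l jy.
- have -> : (l.-1 <= jy)%N by lia.
  by rewrite andbF; lia.
- have -> : (l.-1 <= jy)%N = (l.-1 == jy) by lia.
  by rewrite andbF; case: eqP; lia.
- have -> : (l.-1 <= jy)%N by lia.
  by case: eqP => ? /=; lia.
Qed.

(** If [jy > 0] all four values follow one additive formula and cancel. If [jy = 0] the two minors
    with exponent 1 at [y] lie beyond the break, and the second difference of an absolute value
    appears as for a face. *)
Lemma triangle_form_edge (n jx jy jz m : nat) :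
  (0 < m)%N -> (m < n)%N -> (jx + jy + jz = n)%N ->
  let c := triangle_form jx jy jz in
  (m - jx)%N%:Z - ((n - m).-1 - jz)%N%:Z - 1 + c m.-1 1%N (n - m)%N
  - (c m 1%N (n - m).-1 + ((m.-1 - jx)%N%:Z - ((n - m) - jz)%N%:Z - 1))
  = (if (m == jx) && (jy == 0%N) then -2 else 0).
Proof.
move=> m0 mn e /=; rewrite /triangle_form.
by case: (ltnP 0 jy); case: eqP => ?; case: eqP => ? /=; lia.
Qed.

(** * Position of pairwise joined points relative to a triangle *)

Section Triangulation.
Variables (k : nat) (T : {set {set 'I_k}}).
Hypothesis hT : ideal_triangulation T.

Lemma triangulation_noncrossing : noncrossing T.
Proof. by have /maxsetP[] := hT. Qed.

Lemma edge_neq x y : [set x; y] \in T -> x != y.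
Proof.
move=> xy; have /forall_inP/(_ _ xy)/andP[] := triangulation_noncrossing.
by rewrite cards2 eqSS; case: (x != y).
Qed.

Lemma edges_noncrossing a b c d : [set a; c] \in T -> [set b; d] \in T ->
  cyc a b c -> cyc c d a -> False.
Proof.
move=> ac bd h1 h2.
have /forall_inP/(_ _ ac)/andP[_ /forall_inP/(_ _ bd)] := triangulation_noncrossing.
case/negP; apply/existsP; exists a; apply/existsP; exists b.
by apply/existsP; exists c; apply/existsP; exists d; rewrite !eqxx h1 h2.
Qed.

Lemma triangle_rot x y z : triangle T x y z = triangle T y z x.
Proof.
rewrite /triangle (setUC [set z] [set x]) (setUC [set y] [set x]).
by do 3!case: (_ \in T).
Qed.

Lemma triangle_edge x y z r s : triangle T x y z ->
  r \in [:: x; y; z] -> s \in [:: x; y; z] -> r != s -> [set r; s] \in T.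
Proof.
case/and3P=> xy yz xz; rewrite !inE.
by do 2!(case/or3P => /eqP ->); rewrite ?eqxx // => _; rewrite setUC.
Qed.

Definition in_arc (x y r : 'I_k) := [|| r == x, r == y | cyc x r y].

Section Position.
Variable S : seq 'I_k.
Hypothesis cliqueS : forall r s, r \in S -> s \in S -> r != s -> [set r; s] \in T.

(** A point of [S] on the other side of the edge would be joined to [r] by an edge crossing it. *)
Lemma clique_arc x y r : [set x; y] \in T -> r \in S -> cyc x r y ->
  forall s, s \in S -> in_arc x y s.
Proof.
move=> xy rS xry s sS; have [rs | rs] := eqVneq r s; last first.
  have rsT := cliqueS rS sS rs.
  have h : ~ cyc y s x by move=> ysx; exact: (edges_noncrossing xy rsT xry ysx).
  have := edge_neq xy.
  by move: xry rs h; rewrite /in_arc /cyc !ord_eqE; lia.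
by rewrite /in_arc -rs xry !orbT.
Qed.

(** A point of [S] strictly inside one of the three arcs confines [S] to that closed arc by
    [clique_arc]; if there is none, only the vertices of the triangle are left. *)
Lemma clique_position x y z : cyc x y z -> triangle T x y z ->
  [\/ {subset S <= [:: x; y; z]}, {in S, forall s, in_arc x y s},
      {in S, forall s, in_arc y z s} | {in S, forall s, in_arc z x s}].
Proof.
move=> xyz /and3P[xy yz]; rewrite setUC => zx.
have [/hasP[r rS rc]|/hasPn hxy] := boolP (has (fun r => cyc x r y) S).
  by constructor 2 => s; exact: clique_arc rc _.
have [/hasP[r rS rc]|/hasPn hyz] := boolP (has (fun r => cyc y r z) S).
  by constructor 3 => s; exact: clique_arc rc _.
have [/hasP[r rS rc]|/hasPn hzx] := boolP (has (fun r => cyc z r x) S).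
  by constructor 4 => s; exact: clique_arc rc _.
constructor 1 => s sS; move: xyz (hxy s sS) (hyz s sS) (hzx s sS).
by rewrite /cyc !inE !ord_eqE; lia.
Qed.
End Position.
End Triangulation.

(** * Bracket of a coordinate with the minor at a vertex *)

Section VertexBracket.
Variables (F : fieldType) (k n : nat).
Local Notation point := ('I_k * 'I_n)%type.
Variables (v : point -> 'rV[F]_n) (dp : point -> 'I_n -> F -> F).
Hypothesis der_dp : forall p i, derivation (dp p i).
Hypothesis dp_v : forall p q i j, dp p i (v q 0 j) = ((p == q) && (i == j))%:R.
Hypothesis Omega_neq0 : forall s, uniq s -> size s = n -> Omega (map v s) != 0.
Local Notation O s := (Omega (map v s)).
Local Notation log_canonical := (log_canonical v dp).
Local Notation D x y z a b c := (O (block n x a ++ block n y b ++ block n z c)).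

Variable T : {set {set 'I_k}}.
Hypothesis hT : ideal_triangulation T.

Section Target.
Variables (x' y' z' : 'I_k) (a' b' c' : nat).
Hypothesis u' : uniq [:: x'; y'; z'].
Hypothesis T' : triangle T x' y' z'.
Hypothesis abc' : (a' + b' + c' = n)%N.
Local Notation J := (vert x' y' z' a' b' c').
Local Notation t := (block n x' a' ++ block n y' b' ++ block n z' c').

Let tJ : initial t J. Proof. exact: initial_blocks. Qed.

Let J_in r : (0 < J r)%N -> r \in [:: x'; y'; z'].
Proof. by apply: contraTT => /vert_out ->. Qed.

Let J_clique r s : r \in [:: x'; y'; z'] -> s \in [:: x'; y'; z'] -> r != s ->
  [set r; s] \in T.
Proof. exact: triangle_edge. Qed.

Let J_arc x y : {in [:: x'; y'; z'], forall s, in_arc x y s} ->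
  forall r, (0 < J r)%N -> [|| r == x, r == y | cyc x r y].
Proof. by move=> h r /J_in /h. Qed.

Let J_sub x y z : {subset [:: x'; y'; z'] <= [:: x; y; z]} ->
  forall r, r \notin [:: x; y; z] -> J r = 0%N.
Proof. by move=> h r rn; apply: vert_out; apply: contra rn; exact: h. Qed.

Let J_total x y z : uniq [:: x; y; z] ->
  (forall r, r \notin [:: x; y; z] -> J r = 0%N) -> (J x + J y + J z = n)%N.
Proof.
move=> u h.
have := sum_vert (H := fun _ i => i%:Z) a' b' c' u' (fun=> erefl).
rewrite (big_support u) => [|r /h -> //].
rewrite !big_cons big_nil => H; move: abc'; lia.
Qed.

Let vert_J x y z m l p : uniq [:: x; y; z] ->
  (forall r, r \notin [:: x; y; z] -> J r = 0%N) -> (m + l + p = n)%N ->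
  (vert x y z m l p == J) = (m == J x) && (l == J y).
Proof.
move=> u h e; have e' := J_total u h; apply/eqP/andP => [<-|[/eqP mx /eqP ly]].
  by rewrite !vert_val.
apply/ffunP => r; have [rin|rout] := boolP (r \in [:: x; y; z]); last first.
  by rewrite vert_out // h.
move: rin; rewrite !inE => /or3P[] /eqP ->; rewrite vert_val //.
by move: e e'; rewrite mx ly => <- /eqP; rewrite eqn_add2l => /eqP.
Qed.

Let arc_face x y z m l p : cyc x y z ->
  (0 < m)%N -> (0 < l)%N -> (0 < p)%N -> (m + l + p = n)%N ->
  {in [:: x'; y'; z'], forall s, in_arc x y s} \/
  {in [:: x'; y'; z'], forall s, in_arc y z s} \/
  {in [:: x'; y'; z'], forall s, in_arc z x s} ->
  log_canonical (face_coord v x y z m l p) (O t)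
    (if vert x y z m l p == J then -2 else 0).
Proof.
move=> xyz m0 l0 p0 e h; have u := cyc_uniq xyz.
(* The face vertex has a positive coordinate at the corner of its triangle off the arc, where [J]
   vanishes. *)
have -> : (vert x y z m l p == J) = false.
  apply/eqP => E0; have E r : vert x y z m l p r = J r by rewrite E0.
  case: h => [|[]] h.
  - have := E z; have := @J_arc _ _ h z; rewrite vert_val //.
    by move: xyz; rewrite /cyc !ord_eqE; lia.
  - have := E x; have := @J_arc _ _ h x; rewrite vert_val //.
    by move: xyz; rewrite /cyc !ord_eqE; lia.
  - have := E y; have := @J_arc _ _ h y; rewrite vert_val //.
    by move: xyz; rewrite /cyc !ord_eqE; lia.
have : exists C H, (forall r, H r 0%N = 0) /\ forall s I, initial s I ->
    (forall r, (0 < I r)%N -> r \in [:: x; y; z]) ->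
    log_canonical (O s) (O t) (C + \sum_r H r (I r)).
  case: h => [|[]] h.
  - have [|C [H [H0 lH]]] := log_canonical_arc der_dp dp_v tJ _ (J_arc h).
      by move: xyz; rewrite /cyc !ord_eqE; lia.
    exists C, H; split=> // s I sI Iin; apply: lH => // r /Iin.
    by move: xyz; rewrite /cyc !inE !ord_eqE; lia.
  - have [|C [H [H0 lH]]] := log_canonical_arc der_dp dp_v tJ _ (J_arc h).
      by move: xyz; rewrite /cyc !ord_eqE; lia.
    exists C, H; split=> // s I sI Iin; apply: lH => // r /Iin.
    by move: xyz; rewrite /cyc !inE !ord_eqE; lia.
  - have [|C [H [H0 lH]]] := log_canonical_arc der_dp dp_v tJ _ (J_arc h).
      by move: xyz; rewrite /cyc !ord_eqE; lia.
    exists C, H; split=> // s I sI Iin; apply: lH => // r /Iin.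
    by move: xyz; rewrite /cyc !inE !ord_eqE; lia.
by case=> C [H [H0 lH]]; apply: (face_additive der_dp Omega_neq0 u m0 l0 p0 e H0 lH).
Qed.

Lemma face_bracket x y z m l p : cyc x y z -> triangle T x y z ->
  (0 < m)%N -> (0 < l)%N -> (0 < p)%N -> (m + l + p = n)%N ->
  log_canonical (face_coord v x y z m l p) (O t)
    (if vert x y z m l p == J then -2 else 0).
Proof.
move=> xyz Txyz m0 l0 p0 e; have u := cyc_uniq xyz.
case: (clique_position hT J_clique xyz Txyz) => h;
  try by apply: arc_face => //; tauto.
have h' := J_sub h; rewrite vert_J //.
pose L r i : int := (before x r *+ 2) * (i%:Z - (J r)%:Z).
pose c a b d := triangle_form (J x) (J y) (J z) a b d + (L x a + L y b + L z d).
apply: log_canonical_eq (log_canonical_face der_dp Omega_neq0 (c := c) u m0 l0 p0 e _) _.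
  move=> a b d abd; apply: (log_canonical_triangle der_dp dp_v xyz tJ h').
  exact: initial_blocks.
(* The terms [L] are additive and cancel, which leaves the combination of [triangle_form]. *)
rewrite -(triangle_form_face m0 l0 p0 (etrans e (esym (J_total u h')))) /c.
by ring.
Qed.

(** Only the multiplicities of the lists [g1], ..., [g4] are prescribed: seen from the other side of
    the edge, the same minors have their blocks rotated. *)
Let triangle_edge_bracket x y z w m g1 g2 g3 g4 : cyc x y z -> cyc x z w ->
  (0 < m)%N -> (m < n)%N ->
  (forall r, r \notin [:: x; y; z] -> J r = 0%N) ->
  initial g1 (vert x z w m (n - m).-1 1) -> initial g2 (vert x y z m.-1 1 (n - m)) ->
  initial g3 (vert x y z m 1 (n - m).-1) -> initial g4 (vert x z w m.-1 (n - m) 1) ->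
  exists c1 c2 c3 c4, [/\ log_canonical (O g1) (O t) c1,
    log_canonical (O g2) (O t) c2, log_canonical (O g3) (O t) c3,
    log_canonical (O g4) (O t) c4
    & (c1 + c2) - (c3 + c4) = if vert x y z m 0 (n - m) == J then -2 else 0].
Proof.
move=> xyz xzw m0 mn h i1 i2 i3 i4; have u := cyc_uniq xyz.
pose L r i : int := (before x r *+ 2) * (i%:Z - (J r)%:Z).
do 4!eexists; split.
- exact: (log_canonical_triangle_edge der_dp dp_v xyz tJ h xzw i1).
- exact: (log_canonical_triangle der_dp dp_v xyz tJ h i2).
- exact: (log_canonical_triangle der_dp dp_v xyz tJ h i3).
- exact: (log_canonical_triangle_edge der_dp dp_v xyz tJ h xzw i4).
rewrite vert_J //; last by clear - m0 mn; lia.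
rewrite (eq_sym 0%N) -(triangle_form_edge m0 mn (J_total u h)) /=.
by ring.
Qed.

Let arc_edge x y z w m : cyc x y z -> cyc x z w ->
  (0 < m)%N -> (m < n)%N ->
  {in [:: x'; y'; z'], forall s, in_arc x y s} \/
  {in [:: x'; y'; z'], forall s, in_arc y z s} \/
  {in [:: x'; y'; z'], forall s, in_arc z w s} \/
  {in [:: x'; y'; z'], forall s, in_arc w x s} ->
  log_canonical (edge_coord v x y z w m) (O t)
    (if vert x y z m 0 (n - m) == J then -2 else 0).
Proof.
move=> xyz xzw m0 mn h; have u := cyc_uniq xyz; have uw := cyc_uniq xzw.
have -> : (vert x y z m 0 (n - m) == J) = false.
  apply/eqP => E0; have E r : vert x y z m 0 (n - m) r = J r by rewrite E0.
  case: h => [|[|[]]] h.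
  - have := E z; have := @J_arc _ _ h z; rewrite vert_val //.
    by move: xyz; rewrite /cyc !ord_eqE; lia.
  - have := E x; have := @J_arc _ _ h x; rewrite vert_val //.
    by move: xyz; rewrite /cyc !ord_eqE; lia.
  - have := E x; have := @J_arc _ _ h x; rewrite vert_val //.
    by move: xzw; rewrite /cyc !ord_eqE; lia.
  - have := E z; have := @J_arc _ _ h z; rewrite vert_val //.
    by move: xzw; rewrite /cyc !ord_eqE; lia.
have : exists C H, (forall r, H r 0%N = 0) /\ forall s I, initial s I ->
    (forall r, (0 < I r)%N -> r \in [:: x; y; z; w]) ->
    log_canonical (O s) (O t) (C + \sum_r H r (I r)).
  case: h => [|[|[]]] h;
  (have [|C [H [H0 lH]]] := log_canonical_arc der_dp dp_v tJ _ (J_arc h);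
    [ by move: xyz xzw; rewrite /cyc !ord_eqE; lia
    | exists C, H; split=> // s I sI Iin; apply: lH => // r /Iin;
      by move: xyz xzw; rewrite /cyc !inE !ord_eqE; lia ]).
by case=> C [H [H0 lH]]; apply: (edge_additive der_dp Omega_neq0 u uw m0 mn H0 lH).
Qed.

(** The target triangle is located first relative to [x y z], then, if it lies beyond the edge [xz],
    relative to [x z w]. *)
Lemma edge_bracket x y z w m : cyc x y z -> triangle T x y z ->
  cyc x z w -> triangle T x z w -> (0 < m)%N -> (m < n)%N ->
  log_canonical (edge_coord v x y z w m) (O t)
    (if vert x y z m 0 (n - m) == J then -2 else 0).
Proof.
move=> xyz Txyz xzw Txzw m0 mn; have u := cyc_uniq xyz; have uw := cyc_uniq xzw.
have s1 : (m + (n - m).-1 + 1 = n)%N by clear - m0 mn; lia.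
have s2 : (m.-1 + 1 + (n - m) = n)%N by clear - m0 mn; lia.
have s3 : (m + 1 + (n - m).-1 = n)%N by clear - m0 mn; lia.
have s4 : (m.-1 + (n - m) + 1 = n)%N by clear - m0 mn; lia.
have i1 := initial_blocks uw s1; have i2 := initial_blocks u s2.
have i3 := initial_blocks u s3; have i4 := initial_blocks uw s4.
have inside : {subset [:: x'; y'; z'] <= [:: x; y; z]} ->
    log_canonical (edge_coord v x y z w m) (O t)
      (if vert x y z m 0 (n - m) == J then -2 else 0).
  move=> h; have [c1 [c2 [c3 [c4 [h1 h2 h3 h4 <-]]]]] :=
    triangle_edge_bracket xyz xzw m0 mn (J_sub h) i1 i2 i3 i4.
  exact: (log_canonical_edge der_dp Omega_neq0 u uw m0 mn).
case: (clique_position hT J_clique xyz Txyz) => h;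
  try by apply: arc_edge => //; tauto.
  exact: inside.
case: (clique_position hT J_clique xzw Txzw) => h' //;
  try by apply: arc_edge => //; tauto.
(* The target lies in [x z w]. Exchanging [x] with [z], [y] with [w] and [m] with [n - m] reduces to
   the previous situation. *)
- have zwx : cyc z w x by apply: cyc_rot.
  have zxy : cyc z x y by do 2!apply: cyc_rot.
  have nm0 : (0 < n - m)%N by clear - m0 mn; lia.
  have nmn : (n - m < n)%N by clear - m0 mn; lia.
  rewrite vert_rot vert_rot -[m in vert _ _ _ _ m _](subKn (ltnW mn)).
  have -> : vert z x y (n - m) (n - (n - m)) 0 = vert z w x (n - m) 0 (n - (n - m)).
    by apply/ffunP => r; rewrite !ffunE; clear; lia.
  have h2 : {subset [:: x'; y'; z'] <= [:: z; w; x]}.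
    by move=> r /h'; rewrite !inE; case/or3P=> ->; rewrite ?orbT.
  have e1 : (n - (n - m)).-1 = m.-1 by clear - m0 mn; lia.
  have e2 : (n - (n - m) = m)%N by clear - m0 mn; lia.
  have [||||c1 [c2 [c3 [c4 [h1' h2' h3' h4' <-]]]]] :=
    triangle_edge_bracket (m := n - m)
      (g1 := block n x m.-1 ++ block n y 1 ++ block n z (n - m))
      (g2 := block n x m ++ block n z (n - m).-1 ++ block n w 1)
      (g3 := block n x m.-1 ++ block n z (n - m) ++ block n w 1)
      (g4 := block n x m ++ block n y 1 ++ block n z (n - m).-1)
      zwx zxy nm0 nmn (J_sub h2).
  + by rewrite e1 vert_rot.
  + by rewrite e2 -vert_rot.
  + by rewrite e1 -vert_rot.
  + by rewrite e2 vert_rot.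
  apply: log_canonical_eq (log_canonical_edge der_dp Omega_neq0 u uw m0 mn h2' h1' h4' h3') _.
  by ring.
(* The closed arcs from [z] to [x] and from [x] to [z] have only [x] and [z] in common. *)
- apply: inside => r rS; move: (h r rS) (h' r rS) xyz; clear.
  by rewrite /in_arc /cyc !inE !ord_eqE; lia.
Qed.

End Target.
End VertexBracket.

(** * Arrows of the quiver *)

Lemma cyc_total k (x y z : 'I_k) : x != y -> y != z -> x != z -> cyc x y z || cyc x z y.
Proof. by rewrite /cyc !ord_eqE; lia. Qed.

Section TriangleSums.
Variables (k : nat) (T : {set {set 'I_k}}).
Definition increasing (p : 'I_k * ('I_k * 'I_k)) : bool :=
  [&& p.1 < p.2.1, p.2.1 < p.2.2 & triangle T p.1 p.2.1 p.2.2]%N.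

(** Rotates a cyclically ordered triple to its increasing form; being a rotation, it does not change
    the value of a rotation-invariant [f]. *)
Definition sort3 (x y z : 'I_k) : 'I_k * ('I_k * 'I_k) :=
  if (x < y < z)%N then (x, (y, z)) else
  if (y < z < x)%N then (y, (z, x)) else (z, (x, y)).

Lemma sort3_increasing x y z : cyc x y z -> triangle T x y z -> increasing (sort3 x y z).
Proof.
move=> xyz t; have t' : triangle T y z x by rewrite -triangle_rot.
have t'' : triangle T z x y by rewrite -triangle_rot.
rewrite /increasing /sort3; case: ifP => [/andP[-> ->] //|h].
case: ifP => [/andP[-> ->] //|h'].
by rewrite t'' andbT; move: xyz; rewrite /cyc h h' => /andP[-> ->].
Qed.

Lemma increasing_sort3 p x y z : cyc x y z -> increasing p ->
  x \in [:: p.1; p.2.1; p.2.2] -> y \in [:: p.1; p.2.1; p.2.2] ->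
  z \in [:: p.1; p.2.1; p.2.2] -> p = sort3 x y z.
Proof.
case: p => [r [s q]] /=; rewrite /cyc /sort3 !inE => xyz /and3P[/= rs sq _] xp yp zp.
by apply/eqP; case: ifP => ?; last case: ifP => ?;
  move: xyz xp yp zp; rewrite !xpair_eqE !ord_eqE; lia.
Qed.

Section Sums.
Variable f : 'I_k -> 'I_k -> 'I_k -> nat.
Hypothesis f_rot : forall x y z, f x y z = f y z x.

Definition triangle_sum : nat :=
  (\sum_(x < k) \sum_(y < k | x < y) \sum_(z < k | (y < z) && triangle T x y z)
    f x y z)%N.

Lemma triangle_sumE :
  triangle_sum = (\sum_(p | increasing p) f p.1 p.2.1 p.2.2)%N.
Proof.
rewrite /triangle_sum.
under [LHS]eq_bigr => x _ do
  rewrite (pair_big_dep (fun y : 'I_k => x < y)%N (fun y z : 'I_k => (y < z)%N && triangle T x y z)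
    (fun y z => f x y z)).
by rewrite (pair_big_dep xpredT
  (fun (x : 'I_k) (q : 'I_k * 'I_k) => (x < q.1)%N && ((q.1 < q.2)%N && triangle T x q.1 q.2))
  (fun (x : 'I_k) (q : 'I_k * 'I_k) => f x q.1 q.2)).
Qed.

Lemma f_sort3 x y z : f (sort3 x y z).1 (sort3 x y z).2.1 (sort3 x y z).2.2 = f x y z.
Proof.
by rewrite /sort3; case: ifP => // _; case: ifP => _ /=; rewrite f_rot.
Qed.

Lemma triangle_sum1 x y z : cyc x y z -> triangle T x y z ->
  (forall r s q, f r s q != 0%N -> {subset [:: x; y; z] <= [:: r; s; q]}) ->
  triangle_sum = f x y z.
Proof.
move=> xyz t h; rewrite triangle_sumE (bigD1 _ (sort3_increasing xyz t)) /= f_sort3.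
rewrite big1 ?addn0 // => p /andP[ip]; apply: contraNeq => /h sub.
by apply/eqP; apply: increasing_sort3 => //; apply: sub; rewrite !inE eqxx ?orbT.
Qed.

Hypothesis hT : ideal_triangulation T.

(** Two different apexes on one side of [xz] would yield crossing edges: [xy] with [wz], or [xw]
    with [yz], according to their order. *)
Lemma apex_unique x y z w : cyc x y z -> cyc x w z ->
  [set x; y] \in T -> [set y; z] \in T -> [set x; w] \in T -> [set w; z] \in T ->
  w = y.
Proof.
move=> xyz xwz xy yz xw wz; have [// | wy] := eqVneq w y; exfalso.
have : cyc x w y || cyc x y w.
  by apply: cyc_total; rewrite ?(edge_neq hT xy) ?(edge_neq hT xw).
case/orP => h.
  by apply: (edges_noncrossing hT xy wz h); apply: cyc_rot.
by apply: (edges_noncrossing hT xw yz h); apply: cyc_rot.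
Qed.

Lemma triangle_sum2 x y z t : cyc x y z -> triangle T x y z ->
  cyc x z t -> triangle T x z t ->
  (forall r s q, f r s q != 0%N -> (x \in [:: r; s; q]) && (z \in [:: r; s; q])) ->
  triangle_sum = (f x y z + f x z t)%N.
Proof.
move=> xyz t1 xzt t2 h; have i1 := sort3_increasing xyz t1; have i2 := sort3_increasing xzt t2.
have ne : sort3 x z t != sort3 x y z.
  rewrite /sort3; move: xyz xzt; clear; rewrite /cyc.
  by do ?case: ifP => ?; rewrite !xpair_eqE !ord_eqE; lia.
rewrite triangle_sumE (bigD1 _ i1) (bigD1 (sort3 x z t)) /=; last by rewrite i2.
rewrite !f_sort3 big1 ?addn0 // => p /andP[/andP[ip]] n1 n2; apply/eqP.
apply/negPn/negP => /h /andP[xp zp].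
have xz : x != z by case/and3P: t1 => _ _ /(edge_neq hT).
(* The third vertex of a contributing triangle lies on one side of [xz], so [apex_unique] identifies
   it with [y] or [t]. *)
have [w wp wxz] : exists2 w, w \in [:: p.1; p.2.1; p.2.2] & (w != x) && (w != z).
  have u : uniq [:: p.1; p.2.1; p.2.2].
    case/and3P: ip; clear; rewrite /= !inE !ord_eqE; lia.
  have : has (fun w => (w != x) && (w != z)) [:: p.1; p.2.1; p.2.2].
    apply: contraTT xz => /hasPn h'.
    have := @uniq_leq_size _ _ [:: x; z] u.
    suff H : {subset [:: p.1; p.2.1; p.2.2] <= [:: x; z]} by move/(_ H).
    by move=> r /h'; rewrite !inE -negb_or negbK.
  by case/hasP=> w; exists w.
have tp : triangle T p.1 p.2.1 p.2.2 by case/and3P: ip.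
have wx : [set w; x] \in T.
  by apply: triangle_edge tp _ _ _ => //; case/andP: wxz.
have wz : [set w; z] \in T.
  by apply: triangle_edge tp _ _ _ => //; case/andP: wxz.
have xw : [set x; w] \in T by rewrite setUC.
have zw : [set z; w] \in T by rewrite setUC.
have/and3P[xy yz _] := t1; have/and3P[_ zt xt] := t2.
have yx : [set y; x] \in T by rewrite setUC.
have tz : [set t; z] \in T by rewrite setUC.
have tx : [set t; x] \in T by rewrite setUC.
have zy : [set z; y] \in T by rewrite setUC.
have : (w == y) || (w == t).
  have /orP[c|c] : cyc x w z || cyc x z w.
    by case/andP: wxz => wx' wz'; apply: cyc_total; rewrite // eq_sym.
  - by rewrite (apex_unique xyz c xy yz xw wz) eqxx.
  - by rewrite (apex_unique (cyc_rot xzt) (cyc_rot c) zt tx zw wx) eqxx orbT.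
case/orP=> /eqP e; rewrite e in wp.
  by case/negP: n1; rewrite (increasing_sort3 xyz ip).
by case/negP: n2; rewrite (increasing_sort3 xzt ip).
Qed.

End Sums.
End TriangleSums.

Lemma big_ord3_1 (n : nat) (P : nat -> nat -> nat -> bool) (f : nat -> nat -> nat -> nat) A B C :
  (A < n)%N -> (B < n)%N -> (C < n)%N ->
  (forall a b c, P a b c = [&& a == A, b == B & c == C]) ->
  (\sum_(a < n) \sum_(b < n) \sum_(c < n | P a b c) f a b c)%N = f A B C.
Proof.
move=> An Bn Cn PE.
rewrite (bigD1 (Ordinal An)) //= (bigD1 (Ordinal Bn)) //= [X in (X + _ + _)%N](big_pred1 (Ordinal Cn)).
  rewrite big1 ?big1 ?addn0 // => [a|b]; rewrite -val_eqE /= => /negPf ne; last first.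
    by apply: big_pred0 => c; rewrite PE ne andbF.
  by apply: big1 => b _; apply: big_pred0 => c; rewrite PE ne.
by move=> c; rewrite PE !eqxx.
Qed.

Section Arrows.
Variables (k n : nat).
Implicit Types (V W : {ffun 'I_k -> nat}).

Definition in_triangle (x y z : 'I_k) V : bool :=
  (V x + V y + V z == n)%N && (V == vert x y z (V x) (V y) (V z)).

(** The contribution of one triangle to [narrows], with the barycentric coordinates read off [V]
    instead of summed over. *)
Definition arrows (x y z : 'I_k) V W : nat :=
  (in_triangle x y z V *
   (((0 < V z) && (W == vert x y z (V x).+1 (V y) (V z).-1))
    + ((0 < V x) && (W == vert x y z (V x).-1 (V y).+1 (V z)))
    + ((0 < V y) && (W == vert x y z (V x) (V y).-1 (V z).+1))))%N.

Lemma in_triangle_rot x y z V : in_triangle x y z V = in_triangle y z x V.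
Proof. by rewrite /in_triangle (vert_rot x) -(addnA (V x)) (addnC (V x)). Qed.

Lemma arrows_rot x y z V W : arrows x y z V W = arrows y z x V W.
Proof.
rewrite /arrows (in_triangle_rot x); congr (_ * _)%N.
by rewrite !(vert_rot x y z) -addnA [LHS]addnC.
Qed.

Lemma vert_eq (x y z : 'I_k) a b c a' b' c' : uniq [:: x; y; z] ->
  (vert x y z a b c == vert x y z a' b' c') = [&& a == a', b == b' & c == c'].
Proof.
move=> u; apply/eqP/and3P => [e|[/eqP -> /eqP -> /eqP ->] //].
have := congr1 (fun V : {ffun 'I_k -> nat} => V x) e.
have := congr1 (fun V : {ffun 'I_k -> nat} => V y) e.
have := congr1 (fun V : {ffun 'I_k -> nat} => V z) e.
by rewrite !vert_val // => -> -> ->.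
Qed.

Lemma in_triangle_vert (x y z : 'I_k) a b c : uniq [:: x; y; z] ->
  (a + b + c = n)%N -> in_triangle x y z (vert x y z a b c).
Proof. by move=> u e; rewrite /in_triangle !vert_val // e !eqxx. Qed.

Lemma narrowsE (T : {set {set 'I_k}}) V W : ~~ corner n V -> ~~ corner n W ->
  narrows n T V W = triangle_sum T (fun x y z => arrows x y z V W).
Proof.
move=> nV nW; apply: eq_bigr => x _; apply: eq_bigr => y xy; apply: eq_bigr => z.
case/andP=> yz _.
have u : uniq [:: x; y; z] by rewrite /= !inE !ord_eqE; lia.
rewrite /arrows; case: (boolP (in_triangle x y z V)) => [/andP[/eqP s /eqP e]|h].
  rewrite mul1n (@big_ord3_1 n.+1
   (fun a b c => [&& a + b + c == n, V == vert x y z a b c,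
                     ~~ corner n V & ~~ corner n W])%N
   (fun a b c => (((0 < c) && (W == vert x y z a.+1 b c.-1))
      + ((0 < a) && (W == vert x y z a.-1 b.+1 c))
      + ((0 < b) && (W == vert x y z a b.-1 c.+1)))%N) (V x) (V y) (V z)) //; try lia.
  move=> a b c; rewrite nV nW !andbT {1}e vert_eq //.
  by rewrite -s; move: (V x) (V y) (V z); clear; lia.
rewrite mul0n big1 // => a _; rewrite big1 // => b _; rewrite big_pred0 // => c.
apply/negP => /and4P[/eqP s /eqP e _ _]; case/negP: h.
by rewrite e in_triangle_vert.
Qed.

Section Vertex.
Variables (x y z : 'I_k) (a b c : nat).
Hypothesis u : uniq [:: x; y; z].
Hypothesis abc : (a + b + c = n)%N.

Lemma arrows_out V : arrows x y z (vert x y z a b c) V =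
  (((0 < c) && (V == vert x y z a.+1 b c.-1))
    + ((0 < a) && (V == vert x y z a.-1 b.+1 c))
    + ((0 < b) && (V == vert x y z a b.-1 c.+1)))%N.
Proof. by rewrite /arrows in_triangle_vert // mul1n !vert_val. Qed.

Lemma arrows_in V : arrows x y z V (vert x y z a b c) =
  (((0 < a) && (V == vert x y z a.-1 b c.+1))
    + ((0 < b) && (V == vert x y z a.+1 b.-1 c))
    + ((0 < c) && (V == vert x y z a b.+1 c.-1)))%N.
Proof.
rewrite /arrows; case: (boolP (in_triangle x y z V)) => [/andP[/eqP s /eqP e]|h].
  rewrite e !vert_val // !vert_eq // mul1n.
  move: (V x) (V y) (V z) s abc; clear => i j h s abc.
  congr (_ + _ + _)%N; congr (nat_of_bool _); lia.
rewrite mul0n; apply/esym/eqP; rewrite !addn_eq0 !eqb0 -andbA; apply/and3P; split;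
  apply: contra h => /andP[h /eqP ->]; apply: in_triangle_vert => //; lia.
Qed.

End Vertex.

Lemma arrows_neq0 r s q V W : arrows r s q V W != 0%N ->
  (forall t, (0 < V t)%N -> t \in [:: r; s; q]) /\
  (forall t, (0 < W t)%N -> t \in [:: r; s; q]).
Proof.
rewrite muln_eq0 negb_or => /andP[]; rewrite eqb0 negbK => /andP[_ /eqP eV] h.
have vo a b c t : (0 < vert r s q a b c t)%N -> t \in [:: r; s; q].
  by apply: contraTT => /vert_out ->.
split=> t; first by rewrite eV; exact: vo.
have [i [j [l ->]]] : exists i j l, W = vert r s q i j l; last exact: vo.
move: h; rewrite !addn_eq0 !eqb0 -!negb_or negbK -orbA.
by case/or3P=> /andP[_ /eqP ->]; do 3!eexists.
Qed.

Variable T : {set {set 'I_k}}.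
Hypothesis hT : ideal_triangulation T.

Lemma corner_vert (x y z : 'I_k) a b c : uniq [:: x; y; z] -> (0 < n)%N ->
  (a < n)%N -> (b < n)%N -> (c < n)%N -> ~~ corner n (vert x y z a b c).
Proof.
move=> u n0 an bn cn; apply/existsP => -[r /eqP].
have [rin|rout] := boolP (r \in [:: x; y; z]); last by rewrite vert_out //; lia.
by move: rin; rewrite !inE => /or3P[] /eqP ->; rewrite vert_val //; lia.
Qed.

(** All arrows at an interior vertex lie in its triangle. The right side is the exponent of the
    minor at [V] in the face coordinate. *)
Lemma eps_face x y z m l p V : cyc x y z -> triangle T x y z ->
  (0 < m)%N -> (0 < l)%N -> (0 < p)%N -> (m + l + p = n)%N -> ~~ corner n V ->
  let c a b d : int := (V == vert x y z a b d)%N%:Z in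
  eps n T (vert x y z m l p) V =
    c m.+1 l p.-1 - c m.+1 l.-1 p + (c m.-1 l.+1 p - c m l.+1 p.-1)
     + (c m l.-1 p.+1 - c m.-1 l p.+1).
Proof.
move=> xyz t m0 l0 p0 e nV c; have u := cyc_uniq xyz.
have nW : ~~ corner n (vert x y z m l p) by apply: corner_vert => //; lia.
have sup r s q : (forall t, (0 < vert x y z m l p t)%N -> t \in [:: r; s; q]) ->
    {subset [:: x; y; z] <= [:: r; s; q]}.
  by move=> h w /[1!inE] /[1!inE] /[1!inE] /or3P[] /eqP ->; apply: h; rewrite vert_val.
rewrite /eps !narrowsE //.
rewrite (triangle_sum1 (fun x y z => arrows_rot x y z _ _) xyz t); last first.
  by move=> r s q /arrows_neq0[/sup].
rewrite (triangle_sum1 (fun x y z => arrows_rot x y z _ _) xyz t); last first.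
  by move=> r s q /arrows_neq0[_ /sup].
rewrite arrows_out // arrows_in // m0 l0 p0 /c /=.
by rewrite !PoszD; ring.
Qed.

Lemma eps_edge x y z t m V : cyc x y z -> triangle T x y z ->
  cyc x z t -> triangle T x z t -> (0 < m)%N -> (m < n)%N -> ~~ corner n V ->
  eps n T (vert x y z m 0 (n - m)) V =
    (V == vert x z t m (n - m).-1 1)%N%:Z + (V == vert x y z m.-1 1 (n - m))%N%:Z
    - ((V == vert x y z m 1 (n - m).-1)%N%:Z + (V == vert x z t m.-1 (n - m) 1)%N%:Z).
Proof.
move=> xyz t1 xzt t2 m0 mn nV; have u := cyc_uniq xyz; have u' := cyc_uniq xzt.
have nm : (0 < n - m)%N by rewrite subn_gt0.
have nW : ~~ corner n (vert x y z m 0 (n - m)) by apply: corner_vert => //; clear - m0 mn; lia.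
have sup r s q : (forall t, (0 < vert x y z m 0 (n - m) t)%N -> t \in [:: r; s; q]) ->
    (x \in [:: r; s; q]) && (z \in [:: r; s; q]).
  by move=> h; apply/andP; split; apply: h; rewrite vert_val.
have eW : vert x y z m 0 (n - m) = vert x z t m (n - m) 0.
  by apply/ffunP => r; rewrite !ffunE mul0n addn0 addn0.
have e1 : (m + 0 + (n - m) = n)%N by clear - m0 mn; lia.
have e2 : (m + (n - m) + 0 = n)%N by clear - m0 mn; lia.
rewrite /eps !narrowsE //.
rewrite (triangle_sum2 (fun x y z => arrows_rot x y z _ _) hT xyz t1 xzt t2); last first.
  by move=> r s q /arrows_neq0[/sup].
rewrite (triangle_sum2 (fun x y z => arrows_rot x y z _ _) hT xyz t1 xzt t2); last first.
  by move=> r s q /arrows_neq0[_ /sup].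
rewrite {2 4}eW !arrows_out // !arrows_in // m0 nm /=.
(* The two triangles put opposite arrows along the edge [xz]. Once their ends are written in the
   same coordinates, these cancel. *)
have -> : vert x z t m.-1 (n - m).+1 0 = vert x y z m.-1 0 (n - m).+1.
  by apply/ffunP => r; rewrite !ffunE mul0n addn0 addn0.
have -> : vert x z t m.+1 (n - m).-1 0 = vert x y z m.+1 0 (n - m).-1.
  by apply/ffunP => r; rewrite !ffunE mul0n addn0 addn0.
by rewrite !PoszD; ring.
Qed.

End Arrows.

(** * Brackets of two coordinates *)

Section CoordinateBracket.
Variables (F : fieldType) (k n : nat).
Local Notation point := ('I_k * 'I_n)%type.
Variables (v : point -> 'rV[F]_n) (dp : point -> 'I_n -> F -> F).
Hypothesis der_dp : forall p i, derivation (dp p i).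
Hypothesis dp_v : forall p q i j, dp p i (v q 0 j) = ((p == q) && (i == j))%:R.
Hypothesis Omega_neq0 : forall s, uniq s -> size s = n -> Omega (map v s) != 0.
Local Notation O s := (Omega (map v s)).
Local Notation log_canonical := (log_canonical v dp).
Local Notation D x y z a b c := (O (block n x a ++ block n y b ++ block n z c)).

Variable T : {set {set 'I_k}}.
Hypothesis hT : ideal_triangulation T.

Variant coordinate : {ffun 'I_k -> nat} -> F -> Prop :=
| coordinate_face (x y z : 'I_k) (m l p : nat) of
    cyc x y z & triangle T x y z
    & (0 < m)%N & (0 < l)%N & (0 < p)%N & (m + l + p = n)%N :
    coordinate (vert x y z m l p) (face_coord v x y z m l p)
| coordinate_edge (x y z t : 'I_k) (m : nat) of
    cyc x y z & triangle T x y z & cyc x z t & triangle T x z t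
    & (0 < m)%N & (m < n)%N :
    coordinate (vert x y z m 0 (n - m)%N) (edge_coord v x y z t m).

Lemma coordinate_not_corner V X : coordinate V X -> ~~ corner n V.
Proof.
case=> [x y z m l p xyz _ m0 l0 p0 e|x y z t m xyz _ _ _ m0 mn];
  by apply: corner_vert (cyc_uniq xyz) _ _ _ _; lia.
Qed.

Lemma coordinate_bracket_vert V X (x y z : 'I_k) a b c : coordinate V X ->
  uniq [:: x; y; z] -> triangle T x y z -> (a + b + c = n)%N ->
  log_canonical X (D x y z a b c) (- ((V == vert x y z a b c)%N%:Z *+ 2)).
Proof.
move=> [x' y' z' m l p xyz t' m0 l0 p0 e|x' y' z' w m xyz t' xzw tw m0 mn] u t abc.
  apply: log_canonical_eq (face_bracket der_dp dp_v Omega_neq0 hT u t abc xyz t' m0 l0 p0 e) _.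
  by case: (_ == _).
apply: log_canonical_eq (edge_bracket der_dp dp_v Omega_neq0 hT u t abc xyz t' xzw tw m0 mn) _.
by case: (_ == _).
Qed.

Lemma coordinate_bracket V W X Y : coordinate V X -> coordinate W Y ->
  log_canonical X Y (eps n T V W *+ 2).
Proof.
move=> cV cW; have nV := coordinate_not_corner cV.
have H (x y z : 'I_k) a b c : uniq [:: x; y; z] -> triangle T x y z -> (a + b + c = n)%N ->
    log_canonical (D x y z a b c) X ((V == vert x y z a b c)%N%:Z *+ 2).
  move=> u t abc; rewrite -[_ *+ 2]opprK; apply: (@log_canonical_anti _ _ _ v dp _ _ _).
  exact: coordinate_bracket_vert.
(* [Y] is moved to the first argument, where it can be expanded into minors, whose brackets with [X]
   are given by [H]. *)
suff: log_canonical Y X (eps n T W V *+ 2).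
  move/(@log_canonical_anti _ _ _ v dp _ _ _) => h; apply: log_canonical_eq h _.
  by rewrite /eps -mulNrn opprB.
case: cW => [x y z m l p xyz t m0 l0 p0 e|x y z w m xyz t xzw tw m0 mn].
  have u := cyc_uniq xyz; apply: log_canonical_eq
    (log_canonical_face der_dp Omega_neq0 u m0 l0 p0 e (fun i j h => H x y z i j h u t)) _.
  by rewrite eps_face //; ring.
have u := cyc_uniq xyz; have u' := cyc_uniq xzw.
have s1 : (m + (n - m).-1 + 1 = n)%N by clear - m0 mn; lia.
have s2 : (m.-1 + 1 + (n - m) = n)%N by clear - m0 mn; lia.
have s3 : (m + 1 + (n - m).-1 = n)%N by clear - m0 mn; lia.
have s4 : (m.-1 + (n - m) + 1 = n)%N by clear - m0 mn; lia.
apply: log_canonical_eq (log_canonical_edge der_dp Omega_neq0 u u' m0 mn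
  (H _ _ _ _ _ _ u' tw s1) (H _ _ _ _ _ _ u t s2)
  (H _ _ _ _ _ _ u t s3) (H _ _ _ _ _ _ u' tw s4)) _.
by rewrite (eps_edge hT xyz t xzw tw m0 mn nV); ring.
Qed.

End CoordinateBracket.

(** * The generic configuration *)

Section ConfField.
Variables (K : fieldType) (k n : nat).
Local Notation point := ('I_k * 'I_n)%type.
Local Notation index := ({: 'I_k * 'I_n * 'I_n}).
Local Notation poly := {mpoly K[#|index|]}.
Local Notation F := (conf_field K k n).

Definition bvar (p : point) (j : 'I_n) : poly := 'X_(enum_rank (p.1, p.2, j)).
Definition generic_vec (p : point) : 'rV[F]_n := \row_j tofrac (bvar p j).
Definition partial (p : point) (i : 'I_n) : F -> F :=
  frac_der (mderiv (enum_rank (p.1, p.2, i))).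

Lemma derivation_mderiv i : derivation (mderiv i : poly -> poly).
Proof. by split=> f g; rewrite ?mderivD ?mderivM. Qed.

Lemma derivation_partial p i : derivation (partial p i).
Proof. exact: frac_derivation (derivation_mderiv _). Qed.

Lemma partial_const p i c : partial p i (const k n c) = 0.
Proof. by rewrite /partial frac_der_tofrac ?mderivC ?tofrac0 //; exact: derivation_mderiv. Qed.

Lemma partial_generic_vec p q i j :
  partial p i (generic_vec q 0 j) = ((p == q) && (i == j))%:R.
Proof.
rewrite mxE /partial frac_der_tofrac; last exact: derivation_mderiv.
rewrite /bvar mderivX mnm1E (inj_eq enum_rank_inj).
have [/andP[/eqP -> /eqP ->]|ne] := boolP ((p == q) && (i == j)).
  by rewrite eqxx scale1r -[X in (X - _)%MM]add0m addmK mpolyX0 tofrac1.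
case: eqP => [[e1 e2 e3]|_]; last by rewrite scale0r tofrac0.
by case/negP: ne; rewrite e3 eqxx andbT; apply/eqP; case: p q e1 e2 {e3} => ? ? [? ?] /= -> ->.
Qed.

Lemma bvec_block r a : bvec K n r a = map generic_vec (block n r a).
Proof.
by rewrite /bvec /block map_take -[in RHS]map_comp; congr take; apply: eq_map.
Qed.

Lemma Omega_generic_neq0 (s : seq point) : uniq s -> size s = n ->
  Omega (map generic_vec s) != 0.
Proof.
move=> us sn.
have -> : Omega (map generic_vec s) =
    tofrac (\det (\matrix_(i < n, j < n) bvar (tnth (Tuple (introT eqP sn)) i) j)).
  rewrite -det_map_mx; congr (\det _); apply/matrixP => i j; rewrite !mxE.
  have p0 := tnth (Tuple (introT eqP sn)) i.
  by rewrite (nth_map p0) ?sn // (tnth_nth p0) mxE.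
rewrite tofrac_eq0; set t := Tuple _.
(* The [i]-th listed vector is specialised to the [i]-th standard basis vector, which turns the
   matrix into the identity. *)
pose e (i : 'I_#|index|) : K :=
  (tnth t (enum_val i).2 == (enum_val i).1)%:R.
suff: meval e (\det (\matrix_(i < n, j < n) bvar (tnth t i) j)) != 0.
  by apply: contraNneq => ->; rewrite meval0.
rewrite -det_map_mx (_ : map_mx _ _ = 1%:M) ?det1 ?oner_eq0 //.
apply/matrixP => i j; rewrite !mxE [LHS]mevalXU /e enum_rankK /= -surjective_pairing.
have inj : injective (tnth t) by apply/tuple_uniqP.
by rewrite (inj_eq inj) eq_sym.
Qed.

End ConfField.

(** * Uniqueness of the bracket on the coordinate field *)

Section FXDerivation.
Variables (K : fieldType) (k n : nat) (T : {set {set 'I_k}}).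
Local Notation F := (conf_field K k n).
Local Notation FX := (@FX K k n T).

Definition FX_derivation (d : F -> F) : Prop :=
  (forall c f g, FX f -> FX g -> d (const k n c * f + g) = const k n c * d f + d g) /\
  (forall f g, FX f -> FX g -> d (f * g) = f * d g + d f * g).

Lemma const0 : const k n (0 : K) = 0.
Proof. by rewrite /const mpoly.mpolyC0 tofrac0. Qed.

Lemma const1 : const k n (1 : K) = 1.
Proof. by rewrite /const mpoly.mpolyC1 tofrac1. Qed.

Lemma FX0 : FX 0. Proof. by rewrite -const0; constructor. Qed.
Lemma FX1 : FX 1. Proof. by rewrite -const1; constructor. Qed.

(** Constants have derivative zero, and the Leibniz rule for [f * f^-1 = 1] determines the
    derivative of an inverse; induction over [FX] does the rest. *)
Lemma FX_derivation_eq (d d' : F -> F) : FX_derivation d -> FX_derivation d' ->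
  (forall V X, FGcoord T V X -> d X = d' X) ->
  forall f, FX f -> d f = d' f.
Proof.
move=> hd hd' h.
have d0 e : FX_derivation e -> e 0 = 0.
  move=> [L _]; have := L 1 0 0 FX0 FX0; rewrite const1 !mul1r addr0 => E.
  by apply: (addrI (e 0)); rewrite -E addr0.
have d1 e : FX_derivation e -> e 1 = 0.
  move=> [_ M]; have := M 1 1 FX1 FX1; rewrite !mul1r mulr1 => E.
  by apply: (addrI (e 1)); rewrite -E addr0.
have dc e c : FX_derivation e -> e (const k n c) = 0.
  move=> he; have [L _] := he; have := L c 1 0 FX1 FX0.
  by rewrite mulr1 addr0 (d0 _ he) (d1 _ he) mulr0 addr0.
have dD e f g : FX_derivation e -> FX f -> FX g -> e (f + g) = e f + e g.
  by move=> [L _] Ff Fg; have := L 1 f g Ff Fg; rewrite const1 !mul1r.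
have dV e f : FX_derivation e -> FX f -> e f^-1 = - (f^-1 * (e f * f^-1)).
  move=> he Ff; have [->|f0] := eqVneq f 0; first by rewrite invr0 (d0 _ he) !mul0r oppr0.
  have [_ M] := he; have := M f f^-1 Ff (FX_inv Ff); rewrite mulfV // (d1 _ he) => E.
  by apply: (mulfI f0); rewrite mulrN mulVKf //; apply/eqP; rewrite -addr_eq0 -E.
move=> f; elim=> [c|V X /h //|f' g Ff If Fg Ig|f' g Ff If Fg Ig|f' Ff If].
- by rewrite (dc d) ?(dc d').
- by rewrite !dD // If Ig.
- by have [_ M] := hd; have [_ M'] := hd'; rewrite M // M' // If Ig.
- by rewrite (dV d f' hd Ff) (dV d' f' hd' Ff) If.
Qed.

End FXDerivation.

Lemma half_double (R : comNzRingType) (h e x y : R) :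
  h * 2%:R = 1 -> h * ((e + e) * x * y) = e * x * y.
Proof. by move=> h2; rewrite -[RHS]mul1r -h2; ring. Qed.

Lemma leibniz_scale (R : comNzRingType) (h f g df dg : R) :
  h * (df * g + f * dg) = f * (h * dg) + h * df * g.
Proof. by ring. Qed.

Section Bracket.
Variables (K : fieldType) (k n : nat).
Hypothesis charK : [pchar K] =i pred0.
Local Notation F := (conf_field K k n).
Local Notation vec := (@generic_vec K k n).
Local Notation d := (@partial K k n).

Definition bracket (f g : F) : F := const k n 2^-1 * swapping vec d f g.

Lemma FG_coordinate (T : {set {set 'I_k}}) V X :
  @FGcoord K k n T V X -> coordinate vec T V X.
Proof.
have D x y z a b c : Omega (bvec K n x a ++ bvec K n y b ++ bvec K n z c)
    = Omega (map vec (block n x a ++ block n y b ++ block n z c)).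
  by rewrite !map_cat !bvec_block.
case=> [x y z m l p xyz t m0 l0 p0 e|x y z t m xyz t1 xzt t2 m0 mn].
  rewrite (_ : Xtri _ _ _ _ _ _ _ _ = face_coord vec x y z m l p); first by constructor.
  by rewrite /Xtri /face_coord !D.
rewrite (_ : Xedge _ _ _ _ _ _ _ = edge_coord vec x y z t m); first by constructor.
by rewrite /Xedge /edge_coord !D.
Qed.

Lemma const2 : const k n (2^-1 : K) * 2%:R = 1.
Proof.
have K2 : (2%:R : K) != 0.
  by apply/negP => h; have := charK 2; rewrite !inE h.
have -> : (2%:R : F) = const k n 2%:R by rewrite /const !mulr2n mpoly.mpolyCD tofracD mpoly.mpolyC1 tofrac1.
by rewrite /const -tofracM -mpoly.mpolyCM mulVf // mpoly.mpolyC1 tofrac1.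
Qed.

Lemma bracket_coord (T : {set {set 'I_k}}) V W X Y : ideal_triangulation T ->
  @FGcoord K k n T V X -> @FGcoord K k n T W Y ->
  bracket X Y = (eps n T V W)%:~R * X * Y.
Proof.
move=> hT /FG_coordinate cX /FG_coordinate cY.
have := coordinate_bracket (@derivation_partial K k n) (@partial_generic_vec K k n)
  (@Omega_generic_neq0 K k n) hT cX cY.
rewrite /log_canonical /bracket => ->.
by rewrite mulr2n intrD half_double // const2.
Qed.

Lemma bracketN f g : bracket f g = - bracket g f.
Proof. by rewrite /bracket swapping_anti mulrN. Qed.

Lemma bracket_FX_derivation (T : {set {set 'I_k}}) h :
  @FX_derivation K k n T (bracket^~ h).
Proof.
have D := derivation_swappingl vec (@derivation_partial K k n) h.
split=> [c f g _ _|f g _ _]; rewrite /bracket.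
  rewrite (derD D) (derM D) /=.
  have -> : swapping vec d (const k n c) h = 0.
    rewrite /swapping big1 // => p _; rewrite big1 // => q _.
    rewrite big1 ?mulr0 // => i _; rewrite big1 // => j _.
    by rewrite partial_const mulr0 mul0r.
  by rewrite mul0r add0r mulrDr mulrCA.
by rewrite (derM D) leibniz_scale.
Qed.

(** Two extensions from the generators: in the first argument with a coordinate in the second one,
    then, after exchanging the arguments by antisymmetry, with any element there. *)
Lemma FGbracket_unique (T : {set {set 'I_k}}) B : ideal_triangulation T ->
  FGbracket T B -> forall f g, @FX K k n T f -> @FX K k n T g -> B f g = bracket f g.
Proof.
move=> hT [anti lin leib co].
have der h : @FX K k n T h -> @FX_derivation K k n T (B^~ h).
  by move=> Fh; split=> *; [exact: lin | exact: leib].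
have H V X f : FGcoord T V X -> @FX K k n T f -> B f X = bracket f X.
  move=> cX; apply: (FX_derivation_eq (der _ (FX_coord cX)) (bracket_FX_derivation T X)).
  by move=> W Y cY; rewrite (co _ _ _ _ cY cX) (bracket_coord hT cY cX).
move=> f g Ff Fg; apply: (FX_derivation_eq (der _ Fg) (bracket_FX_derivation T g)) Ff.
move=> V X cX; rewrite anti //; last exact: FX_coord cX.
by rewrite (H _ _ _ cX Fg) -bracketN.
Qed.

End Bracket.

(** * Determinants of lists of vectors *)

Section OmegaTheory.
Variables (F : fieldType) (n : nat).
Implicit Types (s : seq 'rV[F]_n) (u w : 'rV[F]_n).

Definition rows s : 'M[F]_n := \matrix_(i < n) nth 0 s i.

Lemma OmegaE s : Omega s = \det (rows s). Proof. by []. Qed.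

Lemma Omega_linear s1 s2 a u w : (size s1 < n)%N ->
  Omega (s1 ++ (a *: u + w) :: s2) = a * Omega (s1 ++ u :: s2) + Omega (s1 ++ w :: s2).
Proof.
move=> h; rewrite -[Omega (_ ++ w :: _)]mul1r.
apply: (determinant_multilinear (i0 := Ordinal h)).
- by rewrite !rowK /= !nth_cat ltnn subnn /= scale1r.
- apply/matrixP => i j; rewrite !mxE !nth_cat /=; case: ltnP => // le.
  have : (size s1 < bump (size s1) i)%N.
    by rewrite ltn_neqAle le andbT neq_bump.
  by rewrite -subn_gt0; case: (_ - _)%N.
apply/matrixP => i j; rewrite !mxE !nth_cat /=; case: ltnP => // le.
have : (size s1 < bump (size s1) i)%N.
  by rewrite ltn_neqAle le andbT neq_bump.
by rewrite -subn_gt0; case: (_ - _)%N.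
Qed.

Lemma Omega_nuniq s : size s = n -> ~~ uniq s -> Omega s = 0.
Proof.
move=> sn; case/(uniqPn 0) => i [j [ij]]; rewrite sn => jn e.
have inn := ltn_trans ij jn.
apply: (determinant_alternate (i1 := Ordinal inn) (i2 := Ordinal jn)).
  by rewrite -val_eqE /= neq_ltn ij.
by move=> c; rewrite !mxE /= e.
Qed.

Lemma Omega_mem s1 s2 u : (size (s1 ++ u :: s2) = n)%N -> u \in s1 ->
  Omega (s1 ++ u :: s2) = 0.
Proof.
move=> sn us; apply: Omega_nuniq => //.
by rewrite cat_uniq /= us /= !andbF.
Qed.

Lemma Omega_perm s s' : size s = n -> perm_eq s s' ->
  exists e : bool, Omega s = (-1) ^+ e * Omega s'.
Proof.
move=> sn p; have sn' : size s' = n by rewrite -(perm_size p).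
have /tuple_permP[q e] : perm_eq (Tuple (introT eqP sn)) (Tuple (introT eqP sn')) by [].
exists (odd_perm q); rewrite !OmegaE -det_perm -det_mulmx -row_permE; congr (\det _).
apply/matrixP => i j; rewrite !mxE -(tnth_nth 0 (Tuple (introT eqP sn'))).
rewrite (e : s = _) (nth_map i) ?size_enum_ord //.
by rewrite (_ : nth i _ _ = i) //; apply: ord_inj; rewrite nth_enum_ord.
Qed.

Definition coords s u (i : nat) : F :=
  if insub i is Some j then (u *m invmx (rows s)) 0 (j : 'I_n) else 0.

Lemma coords_sum s u : Omega s != 0 -> u = \sum_(0 <= i < n) coords s u i *: nth 0 s i.
Proof.
move=> Os; have A : rows s \in unitmx by rewrite unitmxE unitfE.
rewrite big_mkord -[LHS](mulmxKV A); apply/rowP => j; rewrite mxE summxE.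
by apply: eq_bigr => i _; rewrite [in RHS]mxE /coords valK; congr (_ * _); rewrite mxE.
Qed.

Lemma Omega_mulmx s (g : 'M[F]_n) : size s = n ->
  Omega (map (fun u => u *m g) s) = Omega s * \det g.
Proof.
move=> sn; rewrite !OmegaE -det_mulmx; congr (\det _).
apply/row_matrixP => i; rewrite row_mul !rowK (nth_map 0) ?sn //.
Qed.

Lemma Omega_sum s1 s2 I (r : seq I) (c : I -> F) (f : I -> 'rV[F]_n) :
  (size s1 < n)%N ->
  Omega (s1 ++ (\sum_(i <- r) c i *: f i) :: s2) =
  \sum_(i <- r) c i * Omega (s1 ++ f i :: s2).
Proof.
move=> h; elim: r => [|a r IH].
  rewrite !big_nil; have := Omega_linear s2 (-1) 0 0 h.
  by rewrite scaler0 addr0 mulN1r addNr.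
by rewrite !big_cons Omega_linear // IH.
Qed.

Definition subfield (S : F -> Prop) : Prop :=
  [/\ S 0, S 1, forall f g, S f -> S g -> S (f - g),
      forall f g, S f -> S g -> S (f * g) & forall f, S f -> S f^-1].

Section Rational.
Variable S : F -> Prop.
Hypothesis hS : subfield S.

Lemma subf0 : S 0. Proof. by case: hS. Qed.
Lemma subf1 : S 1. Proof. by case: hS. Qed.
Lemma subfB f g : S f -> S g -> S (f - g). Proof. by case: hS => _ _ h _ _; exact: h. Qed.
Lemma subfM f g : S f -> S g -> S (f * g). Proof. by case: hS => _ _ _ h _; exact: h. Qed.
Lemma subfV f : S f -> S f^-1. Proof. by case: hS => _ _ _ _ h; exact: h. Qed.
Lemma subfN f : S f -> S (- f).
Proof. by move=> h; rewrite -sub0r; apply: subfB => //; exact: subf0. Qed.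
Lemma subfD f g : S f -> S g -> S (f + g).
Proof. by move=> hf hg; rewrite -[g]opprK; apply: subfB => //; exact: subfN. Qed.
Lemma subf_div f g : S f -> S g -> S (f / g).
Proof. by move=> hf /subfV; exact: subfM. Qed.
Lemma subf_sum I (r : seq I) (P : pred I) f :
  (forall i, P i -> S (f i)) -> S (\sum_(i <- r | P i) f i).
Proof. by move=> h; apply: (big_ind S) => //; [exact: subf0 | exact: subfD]. Qed.

Lemma subf_sum_nat a b f :
  (forall i, (a <= i < b)%N -> S (f i)) -> S (\sum_(a <= i < b) f i).
Proof. by move=> h; rewrite big_nat; apply: subf_sum. Qed.

Definition rational u : Prop := forall j, S (u 0 j).

Lemma rational_Omega s : size s = n -> (forall u, u \in s -> rational u) -> S (Omega s).
Proof.
move=> sn h; rewrite /Omega /determinant; apply: subf_sum => p _.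
apply: subfM; first by case: (odd_perm p); rewrite ?expr1; [apply: subfN|]; exact: subf1.
apply: (big_ind S) => [||i _]; [exact: subf1 | exact: subfM |].
by rewrite mxE; apply: h; rewrite mem_nth // sn.
Qed.

Lemma rationalZ c u : S c -> rational u -> rational (c *: u).
Proof. by move=> hc hu j; rewrite mxE; apply: subfM. Qed.

Lemma rationalB u w : rational u -> rational w -> rational (u - w).
Proof. by move=> hu hw j; rewrite !mxE; apply: subfB. Qed.

Lemma rational_sum_nat a b (f : nat -> 'rV[F]_n) :
  (forall i, (a <= i < b)%N -> rational (f i)) -> rational (\sum_(a <= i < b) f i).
Proof. by move=> h j; rewrite summxE; apply: subf_sum_nat => i /h. Qed.

End Rational.
End OmegaTheory.

(** * Reconstruction of flags from coordinates *)

Section FlagStep.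
Variables (F : fieldType) (n : nat).
Local Notation vec := 'rV[F]_n.
Implicit Types (s : seq vec) (u w : vec).

Lemma mkseq_split T (f : nat -> T) l a : (l < a)%N ->
  mkseq f a = mkseq f l ++ f l :: [seq f i | i <- iota l.+1 (a - l.+1)].
Proof.
move=> la; rewrite /mkseq -{1}(subnKC (ltnW la)) iotaD map_cat add0n.
by rewrite -(subnSK la).
Qed.

Lemma mkseqSr T (f : nat -> T) l : mkseq f l.+1 = rcons (mkseq f l) (f l).
Proof. by rewrite (mkseq_split _ (ltnSn l)) subnn cats1. Qed.

Lemma mem_mkseq (f : nat -> vec) a i : (i < a)%N -> f i \in mkseq f a.
Proof. by move=> ia; apply/mapP; exists i; rewrite ?mem_iota. Qed.

Lemma Omega_sum_mem s1 s2 (r : seq nat) (c : nat -> F) (f : nat -> vec) :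
  (size s1 + (size s2).+1 = n)%N -> (forall i, i \in r -> f i \in s1 ++ s2) ->
  Omega (s1 ++ (\sum_(i <- r) c i *: f i) :: s2) = 0.
Proof.
move=> sn h; rewrite Omega_sum; last by lia.
rewrite big1_seq // => i /andP[_ /h]; rewrite mem_cat => m.
rewrite Omega_nuniq ?mulr0 //; first by rewrite size_cat /=.
by rewrite cat_uniq /=; case/orP: m => -> /=; rewrite !andbF.
Qed.

(** The terms of index below [l] repeat a vector of [s1] and drop out. *)
Lemma Omega_triangular s1 s2 (f : nat -> vec) (c : nat -> F) l :
  (size s1 + (size s2).+1 = n)%N -> (forall i, (i < l)%N -> f i \in s1) ->
  Omega (s1 ++ (\sum_(0 <= i < l.+1) c i *: f i) :: s2)
    = c l * Omega (s1 ++ f l :: s2).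
Proof.
move=> sn h; rewrite big_nat_recr //= addrC Omega_linear; last by lia.
rewrite Omega_sum_mem ?addr0 // => i.
by rewrite mem_index_iota mem_cat => /andP[_ /h ->].
Qed.

Lemma coords_cat (f g : nat -> vec) a b u : (a + b = n)%N ->
  Omega (mkseq f a ++ mkseq g b) != 0 ->
  let c := coords (mkseq f a ++ mkseq g b) u in
  u = \sum_(0 <= i < a) c i *: f i + \sum_(0 <= i < b) c (a + i)%N *: g i.
Proof.
move=> ab O0 c; rewrite {1}(coords_sum u O0) (@big_cat_nat _ _ _ a) //=; last by rewrite -ab leq_addr.
congr (_ + _).
  by apply: eq_big_nat => i /andP[_ ia]; rewrite nth_cat size_mkseq ia nth_mkseq.
rewrite -{1}[a]add0n big_addn (_ : (n - a = b)%N); last by rewrite -ab addKn.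
apply: eq_big_nat => i /andP[_ ib].
by rewrite nth_cat size_mkseq ltnNge leq_addl /= addnK nth_mkseq // addnC.
Qed.

Lemma Omega_sum2_mem s1 s2 (r r' : seq nat) (c c' : nat -> F) (f f' : nat -> vec) :
  (size s1 + (size s2).+1 = n)%N -> (forall i, i \in r -> f i \in s1 ++ s2) ->
  (forall i, i \in r' -> f' i \in s1 ++ s2) ->
  Omega (s1 ++ (\sum_(i <- r) c i *: f i + \sum_(i <- r') c' i *: f' i) :: s2) = 0.
Proof.
move=> sn h h'; rewrite -[X in X + _]scale1r Omega_linear; last by lia.
by rewrite !Omega_sum_mem // mulr0 addr0.
Qed.

Variable S : F -> Prop.
Hypothesis hS : subfield S.

Section Step.
Variables X Y Z : nat -> vec.
Local Notation D a b c := (Omega (mkseq X a ++ mkseq Y b ++ mkseq Z c)).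
Hypothesis D_neq0 : forall a b c, (a + b + c = n)%N -> D a b c != 0.
Hypothesis ratX : forall i, (i < n)%N -> rational S (X i).
Hypothesis ratZ : forall i, (i < n)%N -> rational S (Z i).

(* The new vector is the projection of X_N to Y^(l+1) along X^N, N = n - l - 1. The
   functionals phi_m(u) = Omega(X^m, Y^l, u, Z^(N-m)) vanish on X_j for j < m and on
   Y^l, so the values of their ratios on Y_l are the given ones; the equations
   phi_(m+1)(w) = R phi_m(w) determine the coefficients of w from the last one down. *)
Lemma flag_step l : (l < n)%N -> (forall i, (i < l)%N -> rational S (Y i)) ->
  (forall m, (0 < m)%N -> (m + l < n)%N ->
     S (D m l.+1 (n - (m + l.+1)) / D m.-1 l.+1 (n - (m + l)))) ->
  exists2 b : nat -> F, b l != 0 & rational S (\sum_(0 <= i < l.+1) b i *: Y i).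
Proof.
move=> ln ratY ratio; pose N := (n - l.+1)%N.
have Nl : (N + l.+1 = n)%N by rewrite subnK.
clearbody N.
have ss : size (mkseq X N ++ mkseq Y l.+1) = n by rewrite size_cat !size_mkseq.
have Os : Omega (mkseq X N ++ mkseq Y l.+1) != 0.
  by have := D_neq0 (a := N) (b := l.+1) (c := 0); rewrite cats0; apply; rewrite addn0.
pose c := coords (mkseq X N ++ mkseq Y l.+1) (X N).
pose b i := c (N + i)%N; pose w := \sum_(0 <= i < l.+1) b i *: Y i.
have eX : X N = \sum_(0 <= i < N) c i *: X i + w.
  by rewrite {1}(coords_cat (X N) Nl Os).
have ew : w = X N - \sum_(0 <= i < N) c i *: X i by rewrite {1}eX addrC addKr.
have D0 (a b' : nat) : (a + b' = n)%N -> Omega (mkseq X a ++ mkseq Y b') != 0.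
  by move=> e; have := @D_neq0 a b' 0; rewrite cats0 addn0; exact.
(* Otherwise X_N would lie in X^N + Y^l, against the nonvanishing of the determinant of X^(N+1) and
   Y^l. *)
have b_neq0 : b l != 0.
  have : (N.+1 + l = n)%N by rewrite addSnnS.
  move/D0; apply: contraNneq => bl; rewrite mkseqSr cat_rcons eX.
  rewrite -[X in X + _]scale1r Omega_linear ?size_mkseq; last by lia.
  have sz : (size (mkseq X N) + (size (mkseq Y l)).+1 = n)%N by rewrite !size_mkseq.
  rewrite mul1r Omega_sum_mem // ?add0r => [|i].
    rewrite /w big_nat_recr //= bl scale0r addr0 Omega_sum_mem // => i.
    by rewrite mem_index_iota mem_cat => /andP[_ il]; rewrite (mem_mkseq Y) ?orbT.
  by rewrite mem_index_iota mem_cat => /andP[_ iN]; rewrite mem_mkseq.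
exists b => //.
pose phi m u := Omega (mkseq X m ++ mkseq Y l ++ u :: mkseq Z (n - (m + l.+1))).
have phi_sz m : (m <= N)%N ->
    (size (mkseq X m ++ mkseq Y l) + (size (mkseq Z (n - (m + l.+1)))).+1 = n)%N.
  by move=> mN; rewrite size_cat !size_mkseq; lia.
have phiY m : phi m (Y l) = D m l.+1 (n - (m + l.+1)).
  by rewrite /phi mkseqSr cat_rcons.
have phiw m : (m <= N)%N -> phi m w = b l * phi m (Y l).
  move=> mN; rewrite /phi !catA Omega_triangular ?phi_sz // => i il.
  by rewrite mem_cat (mem_mkseq Y) ?orbT.
have phiX0 m j : (m <= N)%N -> (j < m)%N -> phi m (X j) = 0.
  move=> mN jm; rewrite /phi catA Omega_mem //; first by rewrite size_cat phi_sz.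
  by rewrite mem_cat mem_mkseq.
have phiXX j : (j < N)%N -> phi j (X j) != 0.
  move=> jN; have e : (j.+1 + l + (n - (j + l.+1)) = n)%N by lia.
  have p : perm_eq (mkseq X j.+1 ++ mkseq Y l ++ mkseq Z (n - (j + l.+1)))
      (mkseq X j ++ mkseq Y l ++ X j :: mkseq Z (n - (j + l.+1))).
    by rewrite mkseqSr cat_rcons perm_cat2l -cat1s perm_catCA.
  have [|s es] := Omega_perm _ p; first by rewrite !size_cat !size_mkseq addnA.
  by have := D_neq0 e; rewrite es mulf_eq0 negb_or => /andP[].
have phiwE m : (m <= N)%N ->
    phi m w = phi m (X N) - \sum_(m <= j < N) c j * phi m (X j).
  move=> mN; apply/eqP; rewrite eq_sym subr_eq; apply/eqP.
  have sz : (size (mkseq X m ++ mkseq Y l) < n)%N.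
    by rewrite size_cat !size_mkseq; lia.
  rewrite {1}/phi eX catA -[X in X + w]scale1r Omega_linear //.
  rewrite mul1r Omega_sum // (@big_cat_nat _ _ _ m) //= big_nat big1 => [|j jm].
    by rewrite add0r addrC -!catA; congr (_ + _); apply: eq_bigr => j _; rewrite -catA.
  by have := phiX0 m j mN jm; rewrite /phi catA => ->; rewrite mulr0.
have rphi m u : (m <= N)%N -> rational S u -> S (phi m u).
  move=> mN ru; apply: (rational_Omega hS); first by rewrite catA size_cat phi_sz.
  move=> u'; rewrite !mem_cat inE => /or4P[/mapP[i]|/mapP[i]|/eqP ->//|/mapP[i]];
    rewrite mem_iota add0n => /andP[_ ih] ->; [apply: ratX | exact: ratY | apply: ratZ]; lia.
(* Descending induction on [j], with [i] bounding the distance from [j] to [N]. *)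
have cS : forall i j, (j < N)%N -> (N - j <= i)%N -> S (c j).
  elim=> [|i IH] j jN ji; first by lia.
  have c_big j' : (j < j' < N)%N -> S (c j').
    by move=> /andP[jj' j'N]; apply: IH => //; lia.
  have XN : rational S (X N) by apply: ratX; lia.
  have Sw : S (phi j.+1 w).
    rewrite phiwE //; apply: (subfB hS); first exact: rphi.
    apply: (subf_sum_nat hS) => j' jj'; apply: (subfM hS); first exact: c_big.
    by apply: rphi => //; apply: ratX; clear - jj' Nl; lia.
  have jn : (j.+1 + l < n)%N by lia.
  have rj := ratio j.+1 isT jn; rewrite /= (addSnnS j l) in rj.
  have Sw' : S (phi j w).
    (* By [phiw] the unknown factor [b l] cancels in the ratio of [phi j.+1 w] and [phi j w]. *)
    suff -> : phi j w = phi j.+1 w / (D j.+1 l.+1 (n - (j.+1 + l.+1)) / D j l.+1 (n - (j + l.+1))).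
      exact: (subf_div hS).
    have cancel (p q r : F) : q != 0 -> r != 0 -> p * q = p * r / (r / q).
      by move=> q0 r0; field; rewrite q0 r0.
    by rewrite !phiw ?(ltnW jN) // !phiY; apply: cancel; apply: D_neq0; clear - jN Nl; lia.
  (* In the expansion of [phi j w], [c j] is the only coefficient not yet known to be in [S]. *)
  have cj : c j = (phi j (X N) - \sum_(j.+1 <= j' < N) c j' * phi j (X j') - phi j w) / phi j (X j).
    rewrite phiwE ?(ltnW jN) // (big_ltn jN) //.
    by have := phiXX j jN; move: (phi j (X j)) (\sum_(j.+1 <= _ < N) _) => p q p0; field.
  rewrite cj; apply: (subf_div hS); last by apply: rphi (ltnW jN) _; apply: ratX; lia.
  apply: (subfB hS) => //; apply: (subfB hS); first exact: rphi (ltnW jN) XN.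
  apply: (subf_sum_nat hS) => j' jj'; apply: (subfM hS); first exact: c_big.
  by apply: rphi (ltnW jN) _; apply: ratX; clear - jj' Nl; lia.
rewrite -/w ew; apply: (rationalB hS); first by apply: ratX; lia.
apply: (rational_sum_nat hS) => j /andP[_ jN]; apply: (rationalZ hS).
  exact: (cS (N - j)%N).
by apply: ratX; lia.
Qed.
End Step.
End FlagStep.

(** * Changes of basis and frame preserving the flags *)

Section Adapted.
Variables (F : fieldType) (k n : nat).
Local Notation vec := 'rV[F]_n.
Local Notation family := ('I_k -> nat -> 'rV[F]_n).
Implicit Types (b v : family) (x y z r : 'I_k).

Definition flag_det b x y z i j l : F :=
  Omega (mkseq (b x) i ++ mkseq (b y) j ++ mkseq (b z) l).

(* The basis change at each marked point multiplies r^i by [lam r i], and the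
   change of frame multiplies the volume form by [gam]. *)
Definition adapted v b : Prop := exists gam (lam : 'I_k -> nat -> F),
  [/\ gam != 0, forall r i, lam r i != 0 & forall x y z i j l,
      uniq [:: x; y; z] -> (i + j + l = n)%N ->
      flag_det b x y z i j l = gam * lam x i * lam y j * lam z l * flag_det v x y z i j l].

Lemma flag_det_ext b b' x y z i j l : (forall r, b r =1 b' r) ->
  flag_det b x y z i j l = flag_det b' x y z i j l.
Proof. by move=> e; rewrite /flag_det !(eq_mkseq (e _)). Qed.

Lemma adapted_refl v : adapted v v.
Proof.
by exists 1, (fun _ _ => 1); split=> [|*|*]; rewrite ?oner_eq0 ?mul1r.
Qed.

Lemma adapted_ext v b b' : (forall r, b r =1 b' r) -> adapted v b -> adapted v b'.
Proof.
move=> e [gam [lam [g0 l0 h]]]; exists gam, lam; split=> // x y z i j l u s.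
by rewrite -h // (flag_det_ext _ _ _ _ _ _ e).
Qed.

Lemma adapted_mulmx v b (g : 'M[F]_n) : \det g != 0 -> adapted v b ->
  adapted v (fun r i => b r i *m g).
Proof.
move=> dg [gam [lam [g0 l0 h]]]; exists (gam * \det g), lam; split=> //.
  by rewrite mulf_neq0.
move=> x y z i j l u s.
have -> : flag_det (fun r i => b r i *m g) x y z i j l = flag_det b x y z i j l * \det g.
  rewrite /flag_det -Omega_mulmx ?size_cat ?size_mkseq ?addnA // !map_cat /mkseq.
  by rewrite -!map_comp.
by rewrite h //; ring.
Qed.

Definition update b y l w : family :=
  fun r i => if (r == y) && (i == l) then w else b r i.

Lemma mkseq_update b y l w r a : ~~ ((r == y) && (l < a)%N) ->
  mkseq (update b y l w r) a = mkseq (b r) a.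
Proof.
move=> h; apply/eq_in_map => i; rewrite mem_iota add0n /update => /andP[_ ia].
by case: andP => // -[/eqP e /eqP il]; case/negP: h; rewrite e eqxx -il.
Qed.

Lemma Omega_update b y l w (c : nat -> F) A B a : (l < a)%N ->
  (size A + a + size B = n)%N -> w = \sum_(0 <= i < l.+1) c i *: b y i ->
  Omega (A ++ mkseq (update b y l w y) a ++ B) = c l * Omega (A ++ mkseq (b y) a ++ B).
Proof.
move=> la s ew; rewrite !(mkseq_split _ la) (mkseq_update b (l := l)) ?ltnn ?andbF //.
rewrite {1 2}/update !eqxx /=.
have tl : [seq (if i == l then w else b y i) | i <- iota l.+1 (a - l.+1)]
    = [seq b y i | i <- iota l.+1 (a - l.+1)].
  by apply/eq_in_map => i; rewrite mem_iota; case: eqP => // ->; rewrite ltnn.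
rewrite tl -!catA !cat_cons !(catA A) {1}ew Omega_triangular ?size_cat ?size_mkseq //.
  by rewrite size_map size_iota; lia.
by move=> i il; rewrite mem_cat (mem_mkseq (b y)) ?orbT.
Qed.

(** A triangular change of the vector of index [l] multiplies y^i by [c l] when i > l and leaves the
    smaller exterior powers unchanged. *)
Lemma adapted_update v b y l w (c : nat -> F) : c l != 0 ->
  w = \sum_(0 <= i < l.+1) c i *: b y i -> adapted v b -> adapted v (update b y l w).
Proof.
move=> cl ew [gam [lam [g0 l0 h]]].
pose f r i := if (r == y) && (l < i)%N then c l else 1.
exists gam, (fun r i => lam r i * f r i); split=> // [r i|x1 x2 x3 i j m u s].
  by rewrite mulf_neq0 // /f; case: ifP => // _; exact: oner_neq0.
have E A B r a : (size A + a + size B = n)%N ->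
    Omega (A ++ mkseq (update b y l w r) a ++ B) = f r a * Omega (A ++ mkseq (b r) a ++ B).
  rewrite /f; case: ifP => [/andP[/eqP -> la] s'|/negbT h'].
    exact: Omega_update.
  by rewrite mkseq_update // mul1r.
rewrite /flag_det (E [::]) ?size_cat ?size_mkseq ?addnA // cat0s.
rewrite E ?size_cat ?size_mkseq ?addnA // catA.
rewrite -[mkseq (update _ _ _ _ x3) m]cats0 E ?size_cat ?size_mkseq ?addn0 // cats0 -catA.
by have := h x1 x2 x3 i j m u s; rewrite /flag_det => ->; ring.
Qed.

Lemma adapted_flag v b y (e : nat -> vec) (c : nat -> nat -> F) :
  (forall i, (i < n)%N -> c i i != 0 /\ e i = \sum_(0 <= j < i.+1) c i j *: b y j) ->
  adapted v b -> adapted v (fun r i => if (r == y) && (i < n)%N then e i else b r i).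
Proof.
move=> he hb.
(* The vectors are replaced from the last one down, so that those of smaller index are still the
   ones of [b]. *)
suff H m : (m <= n)%N ->
    adapted v (fun r i => if (r == y) && (n - m <= i < n)%N then e i else b r i).
  by apply: adapted_ext (H n (leqnn n)) => r i; rewrite subnn.
elim: m => [_|m IH mn].
  apply: adapted_ext hb => r i; rewrite subn0.
  by case: ltnP => h; rewrite ?andbF // leqNgt h andbF.
have [c0 ec] := he (n - m.+1)%N ltac:(lia).
apply: adapted_ext (adapted_update (w := e (n - m.+1)%N) c0 _ (IH (ltnW mn))) => [r i|]; last first.
  rewrite ec; apply: eq_big_nat => j /andP[_ jm].
  by rewrite ifN // negb_and; apply/orP; right; lia.
rewrite /update; have [ry|] //= := eqVneq r y.
have [->|ne] := eqVneq i (n - m.+1)%N.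
  by rewrite ifT //; lia.
by have -> : (n - m <= i < n)%N = (n - m.+1 <= i < n)%N by lia.
Qed.

Lemma adapted_neq0 v b x y z i j l : adapted v b -> uniq [:: x; y; z] ->
  (i + j + l = n)%N -> flag_det v x y z i j l != 0 -> flag_det b x y z i j l != 0.
Proof. by move=> [gam [lam [g0 l0 h]]] u s d0; rewrite h // !mulf_neq0. Qed.

Definition flag_face b x y z m l p : F :=
  flag_det b x y z m.+1 l p.-1 / flag_det b x y z m.+1 l.-1 p
  * (flag_det b x y z m.-1 l.+1 p / flag_det b x y z m l.+1 p.-1)
  * (flag_det b x y z m l.-1 p.+1 / flag_det b x y z m.-1 l p.+1).

Definition flag_edge b x y z t m : F :=
  (flag_det b x z t m (n - m).-1 1 * flag_det b x y z m.-1 1 (n - m))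
  / (flag_det b x y z m 1 (n - m).-1 * flag_det b x z t m.-1 (n - m) 1).

Section Invariance.
Variables v b : family.
Hypothesis vb : adapted v b.
Hypothesis v_neq0 : forall x y z i j l, uniq [:: x; y; z] -> (i + j + l = n)%N ->
  flag_det v x y z i j l != 0.

Lemma flag_face_adapted x y z m l p : uniq [:: x; y; z] ->
  (0 < m)%N -> (0 < l)%N -> (0 < p)%N -> (m + l + p = n)%N ->
  flag_face b x y z m l p = flag_face v x y z m l p.
Proof.
move=> u m0 l0 p0 e; have [gam [lam [g0 l0' h]]] := vb.
case: m l p m0 l0 p0 e => [|m] [|l] [|p] // _ _ _ e; rewrite /flag_face /=.
rewrite !h //; try (clear - e; lia).
have d i j q (s : (i + j + q = n)%N) := v_neq0 u s.
by field; rewrite !l0' g0 !d //; clear - e; lia.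
Qed.

Lemma flag_edge_adapted x y z t m : uniq [:: x; y; z] -> uniq [:: x; z; t] ->
  (0 < m)%N -> (m < n)%N -> flag_edge b x y z t m = flag_edge v x y z t m.
Proof.
move=> u u' m0 mn; have [gam [lam [g0 l0' h]]] := vb.
have d i j q (s : (i + j + q = n)%N) := v_neq0 u s.
have d' i j q (s : (i + j + q = n)%N) := v_neq0 u' s.
rewrite /flag_edge !h //; try (clear - m0 mn; lia).
by field; rewrite !l0' g0 ?d ?d' //; clear - m0 mn; lia.
Qed.

End Invariance.
End Adapted.

(** * Extension of rational bases across a triangle *)

Section Reconstruction.
Variables (F : fieldType) (k n : nat) (T : {set {set 'I_k}}).
Local Notation family := ('I_k -> nat -> 'rV[F]_n).
Variable S : F -> Prop.
Hypothesis hS : subfield S.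
Variable v : family.
Hypothesis v_neq0 : forall x y z i j l, uniq [:: x; y; z] -> (i + j + l = n)%N ->
  flag_det v x y z i j l != 0.
Hypothesis face_in : forall x y z m l p, cyc x y z -> triangle T x y z ->
  (0 < m)%N -> (0 < l)%N -> (0 < p)%N -> (m + l + p = n)%N -> S (flag_face v x y z m l p).
Hypothesis edge_in : forall x y z t m, cyc x y z -> triangle T x y z ->
  cyc x z t -> triangle T x z t -> (0 < m)%N -> (m < n)%N -> S (flag_edge v x y z t m).

Definition rational_flag (b : family) r := forall i, (i < n)%N -> rational S (b r i).

(** The ratios that [flag_step] requires for the first vector at [y]. *)
Definition line_ratio (b : family) x y z := forall m, (0 < m)%N -> (m < n)%N ->
  S (flag_det b x y z m 1 (n - (m + 1)) / flag_det b x y z m.-1 1 (n - m)).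

Lemma S_flag_det (b : family) x y z i j l : (i + j + l = n)%N ->
  (forall h, (h < i)%N -> rational S (b x h)) ->
  (forall h, (h < j)%N -> rational S (b y h)) ->
  (forall h, (h < l)%N -> rational S (b z h)) -> S (flag_det b x y z i j l).
Proof.
move=> e hx hy hz; apply: (rational_Omega hS); first by rewrite !size_cat !size_mkseq addnA.
move=> u; rewrite !mem_cat => /or3P[] /mapP[h]; rewrite mem_iota add0n => /andP[_ hh] ->;
  by [apply: hx | apply: hy | apply: hz].
Qed.

Lemma extend_flag_step (b : family) x y z l : cyc x y z -> triangle T x y z ->
  adapted v b -> rational_flag b x -> rational_flag b z -> line_ratio b x y z ->
  (l < n)%N -> (forall i, (i < l)%N -> rational S (b y i)) ->
  exists b', [/\ adapted v b', forall r i, (r != y) || (i < l)%N -> b' r i = b r i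
    & rational S (b' y l)].
Proof.
move=> xyz t vb rx rz ry1 ln ry; have u := cyc_uniq xyz.
have d i j q (s : (i + j + q = n)%N) := adapted_neq0 vb u s (v_neq0 u s).
have [|c c0 rw] := flag_step hS d rx rz ln ry.
  case: l ln ry => [_ _ m m0|l ln ry m m0].
    by rewrite addn0 => mn; have := ry1 m m0 mn; rewrite addn1.
  move=> mln; pose p := (n - (m + l.+1))%N.
  have s : (m + l.+1 + p = n)%N by rewrite subnKC // ltnW.
  have p0 : (0 < p)%N by rewrite subn_gt0.
  have -> : (n - (m + l.+2) = p.-1)%N by rewrite -subnS addnS.
  have := face_in xyz t m0 (ltn0Sn l) p0 s.
  rewrite -(flag_face_adapted vb v_neq0 u m0 (ltn0Sn l) p0 s) => Sf.
  rewrite -/(flag_det b x y z m l.+2 p.-1) -/p -/(flag_det b x y z m.-1 l.+2 p).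
  (* The face coordinate is solved for its two minors of highest exponent at [y]; the other four
     contain only vectors already rational. *)
  have -> : flag_det b x y z m l.+2 p.-1 / flag_det b x y z m.-1 l.+2 p =
      flag_det b x y z m.+1 l.+1 p.-1 / flag_det b x y z m.+1 l p
      * (flag_det b x y z m l p.+1 / flag_det b x y z m.-1 l.+1 p.+1)
      / flag_face b x y z m l.+1 p.
    by rewrite /flag_face /=; field; rewrite !d //; clear -m0 p0 s; lia.
  apply: (subf_div hS) => //; apply: (subfM hS); apply: (subf_div hS);
    apply: S_flag_det; try (clear -m0 p0 s; lia);
    move=> h hh; first [apply: ry | apply: rx | apply: rz]; move: hh; clear -m0 p0 s; lia.
exists (update b y l (\sum_(0 <= i < l.+1) c i *: b y i)); split.
- exact: adapted_update c0 erefl vb.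
- move=> r i; rewrite /update; case: andP => // -[/eqP -> /eqP ->].
  by rewrite eqxx ltnn.
- by rewrite /update !eqxx.
Qed.

Lemma extend_flag (b : family) x y z : cyc x y z -> triangle T x y z ->
  adapted v b -> rational_flag b x -> rational_flag b z -> line_ratio b x y z ->
  exists b', [/\ adapted v b', forall r i, r != y -> b' r i = b r i
    & rational_flag b' y].
Proof.
move=> xyz t vb rx rz ry.
have u := cyc_uniq xyz.
have [xy zy] : x != y /\ z != y.
  by move: u; rewrite /= !inE negb_or (eq_sym y z) => /and3P[/andP[]].
suff H l : (l <= n)%N -> exists b', [/\ adapted v b',
    forall r i, r != y -> b' r i = b r i,
    line_ratio b' x y z & forall i, (i < l)%N -> rational S (b' y i)].
  by have [b' [h1 h2 _ h4]] := H n (leqnn n); exists b'.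
elim: l => [_|l IH ln]; first by exists b.
have [b' [h1 h2 h3 h4]] := IH (ltnW ln).
have [||b'' [g1 g2 g3]] := extend_flag_step xyz t h1 _ _ h3 ln h4.
- by move=> i /rx; rewrite h2.
- by move=> i /rz; rewrite h2.
exists b''; split=> //.
- by move=> r i ry'; rewrite g2 ?ry' // h2.
(* The first vector at [y] is now rational, so the line ratios of the new family are quotients of
   rational determinants. *)
- have r0 i : (i < 1)%N -> rational S (b'' y i).
    by case: i => // _; case: l {IH ln} h4 g2 g3 => [|l] h4 g2 g3 //; rewrite g2 ?orbT //; exact: h4.
  have rx' h : (h < n)%N -> rational S (b'' x h).
    by move=> hn; rewrite g2 ?xy // h2 //; exact: rx.
  have rz' h : (h < n)%N -> rational S (b'' z h).
    by move=> hn; rewrite g2 ?zy // h2 //; exact: rz.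
  move=> m m0 mn; apply: (subf_div hS); apply: S_flag_det => // [|h hh|h hh];
    try (by clear -m0 mn; lia); 
    first [by apply: rx'; clear -hh m0 mn; lia | by apply: rz'; clear -hh m0 mn; lia].
- move=> i; rewrite ltnS leq_eqVlt => /orP[/eqP -> //|il].
  by rewrite g2 ?il ?orbT //; exact: h4.
Qed.

Lemma flag_det_rot (b : family) x y z i j l : (i + j + l = n)%N ->
  exists e : bool, flag_det b y z x j l i = (-1) ^+ e * flag_det b x y z i j l.
Proof.
move=> s; apply: Omega_perm; first by rewrite !size_cat !size_mkseq; clear -s; lia.
by rewrite catA perm_catC.
Qed.

(** The edge coordinate on [xz] is solved for the ratio of its two minors containing the first
    vector at [t]; those with [y] are rational. *)
Lemma edge_line_ratio (b : family) x y z t : cyc x y z -> triangle T x y z ->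
  cyc x z t -> triangle T x z t -> adapted v b ->
  rational_flag b x -> rational_flag b y -> rational_flag b z -> line_ratio b z t x.
Proof.
move=> xyz t1 xzt t2 vb rx ry rz m m0 mn.
have u := cyc_uniq xyz; have u' := cyc_uniq xzt.
have d i j q (s : (i + j + q = n)%N) := adapted_neq0 vb u s (v_neq0 u s).
have d' i j q (s : (i + j + q = n)%N) := adapted_neq0 vb u' s (v_neq0 u' s).
have s1 : (n - (m + 1) + m + 1 = n)%N by clear -m0 mn; lia.
have s2 : (n - m + m.-1 + 1 = n)%N by clear -m0 mn; lia.
(* [line_ratio] lists the blocks as [z], [t], [x] and the coordinate as [x], [z], [t]. Only signs
   change, and the exponent at [x] in the coordinate is [n - m]. *)
have [e1 ->] := flag_det_rot b x z t s1; have [e2 ->] := flag_det_rot b x z t s2.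
have m'0 : (0 < n - m)%N by rewrite subn_gt0.
have m'n : (n - m < n)%N by clear -m0 mn; lia.
have := edge_in xyz t1 xzt t2 m'0 m'n.
rewrite -(flag_edge_adapted vb v_neq0 u u' m'0 m'n) => Se.
have s3 : ((n - m).-1 + 1 + m = n)%N by clear -m0 mn; lia.
have s4 : (n - m + 1 + m.-1 = n)%N by clear -m0 mn; lia.
have S1 : S (flag_det b x y z (n - m).-1 1 m).
  by apply: S_flag_det => // h hh; [apply: rx|apply: ry|apply: rz]; move: hh; clear -m0 mn; lia.
have S2 : S (flag_det b x y z (n - m) 1 m.-1).
  by apply: S_flag_det => // h hh; [apply: rx|apply: ry|apply: rz]; move: hh; clear -m0 mn; lia.
have em : (n - (n - m) = m)%N by rewrite subKn // ltnW.
have em1 : (n - (m + 1) = (n - m).-1)%N by clear -m0 mn; lia.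
rewrite em1 in s1 *; rewrite /flag_edge em in Se.
have sg (e : bool) f : S f -> S ((-1) ^+ e * f).
  by case: e; rewrite ?mul1r // expr1 mulN1r; exact: subfN.
set P := flag_det b x z t (n - m).-1 m 1; set Q := flag_det b x z t (n - m) m.-1 1.
have P0 : P != 0 by exact: d'.
have Q0 : Q != 0 by exact: d'.
have SPQ : S (P / Q).
  rewrite (_ : P / Q = (flag_det b x y z (n - m).-1 1 m / flag_det b x y z (n - m) 1 m.-1)
    / (flag_det b x z t (n - m) m.-1 1 * flag_det b x y z (n - m).-1 1 m /
      (flag_det b x y z (n - m) 1 m.-1 * flag_det b x z t (n - m).-1 m 1))).
    by apply: (subf_div hS) => //; exact: (subf_div hS).
  by rewrite -/P -/Q; field; rewrite P0 Q0 !d //.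
have sgn (f g : F) (e e' : bool) :
    (-1) ^+ e * f / ((-1) ^+ e' * g) = (-1) ^+ (e (+) e') * (f / g).
  rewrite invfM mulrACA; congr (_ * _); case: e; case: e';
  by rewrite /= ?expr0 ?expr1 ?invrN ?invr1 ?mulrNN ?mulr1 ?mul1r.
rewrite sgn; exact: sg.
Qed.

End Reconstruction.

(** * A rational frame for the first triangle *)

Section Start.
Variables (F : fieldType) (k n : nat).
Local Notation family := ('I_k -> nat -> 'rV[F]_n).
Variable S : F -> Prop.
Hypothesis hS : subfield S.
Variable v : family.
Hypothesis v_neq0 : forall x y z i j l, uniq [:: x; y; z] -> (i + j + l = n)%N ->
  flag_det v x y z i j l != 0.

(* [e i] is the difference of the projections of the first vector at [y] on
   x^(i+1) along z^(n-i-1) and on x^i along z^(n-i); it spans the line where x^(i+1)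
   meets z^(n-i), and these vectors add up to the first vector at [y]. *)
Lemma adapted_frame x y z : uniq [:: x; y; z] ->
  exists e : nat -> 'rV[F]_n, exists a c : nat -> nat -> F,
  [/\ forall i, (i < n)%N -> a i i != 0 /\ e i = \sum_(0 <= j < i.+1) a i j *: v x j,
      forall i, (i < n)%N -> c i i != 0 /\
        e (n - i.+1)%N = \sum_(0 <= j < i.+1) c i j *: v z j
    & v y 0%N = \sum_(0 <= i < n) e i].
Proof.
move=> u; pose y0 := v y 0%N.
pose s i := mkseq (v x) i ++ mkseq (v z) (n - i).
have O0 i : (i <= n)%N -> Omega (s i) != 0.
  by move=> ni; have := @v_neq0 x y z i 0 (n - i) u; apply; clear -ni; lia.
pose a0 i := coords (s i) y0; pose c0 i j := a0 i (i + j)%N.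
have y0E i : (i <= n)%N -> y0 = \sum_(0 <= j < i) a0 i j *: v x j
    + \sum_(0 <= j < n - i) c0 i j *: v z j.
  by move=> ni; rewrite {1}(coords_cat (f := v x) (g := v z) y0 (subnKC ni) (O0 i ni)).
(* The minor x^i y^1 z^(n-i-1) is nonzero, so the first vector at [y] is not in the span of the
   vectors of x^i and z^(n-i-1). This makes the diagonal coefficients nonzero. *)
have y_out i (a' c' : nat -> F) : (i < n)%N ->
    y0 <> \sum_(0 <= j < i) a' j *: v x j + \sum_(0 <= j < n - i.+1) c' j *: v z j.
  move=> ni E; have := @v_neq0 x y z i 1 (n - i.+1) u ltac:(lia).
  rewrite /flag_det /= -/y0 E Omega_sum2_mem ?eqxx //.
  - by rewrite !size_mkseq; lia.
  - by move=> j; rewrite mem_index_iota mem_cat => /andP[_ ji]; rewrite mem_mkseq.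
  - by move=> j; rewrite mem_index_iota mem_cat => /andP[_ ji]; rewrite (mem_mkseq (v z)) ?orbT.
pose p i := \sum_(0 <= j < i) a0 i j *: v x j.
pose q i := \sum_(0 <= j < n - i) c0 i j *: v z j.
have pq i : (i <= n)%N -> y0 = p i + q i by exact: y0E.
exists (fun i => p i.+1 - p i).
exists (fun i j => a0 i.+1 j - (if (j < i)%N then a0 i j else 0)).
exists (fun i j => c0 (n - i.+1)%N j - (if (j < i)%N then c0 (n - i)%N j else 0)).
split=> [i ni|i ni|].
- rewrite ltnn subr0; split.
    apply/negP => /eqP ai; apply: (y_out i (a0 i.+1) (c0 i.+1) ni).
    rewrite {1}(y0E i.+1 ni) big_nat_recr //= ai scale0r addr0 //.
  rewrite /p [in RHS]big_nat_recr //= [X in X - _]big_nat_recr //= ltnn subr0.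
  rewrite addrAC; congr (_ + _); rewrite -sumrB; apply: eq_big_nat => j /andP[_ ji].
  by rewrite ji scalerBl.
- have ni' : (n - i.+1 < n)%N by clear -ni; lia.
  have e1 : ((n - i.+1).+1 = n - i)%N by rewrite subnSK.
  have e2 : (n - (n - i.+1) = i.+1)%N by rewrite subKn.
  have e3 : (n - (n - i) = i)%N by rewrite subKn // ltnW.
  rewrite ltnn subr0; split.
    apply/negP => /eqP ci; apply: (y_out _ (a0 (n - i.+1)%N) (c0 (n - i.+1)%N) ni').
    by rewrite {1}(y0E _ (ltnW ni')) e1 e2 e3 [in X in _ + X]big_nat_recr //= ci scale0r addr0.
  rewrite e1.
  (* As [p i + q i] does not depend on [i], a difference of projections to the flag at [x] is also
     one of projections to the flag at [z]. *)
  have -> : p (n - i)%N - p (n - i.+1)%N = q (n - i.+1)%N - q (n - i)%N.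
    apply/eqP; rewrite subr_eq addrAC [X in X - _]addrC -(pq _ (ltnW ni')).
    by rewrite {1}(pq _ (leq_subr i n)) addrK.
  rewrite /q e2 e3 [in RHS]big_nat_recr //= [X in X - _]big_nat_recr //= ltnn subr0.
  rewrite addrAC; congr (_ + _); rewrite -sumrB; apply: eq_big_nat => j /andP[_ ji].
  by rewrite ji scalerBl.
rewrite telescope_sumr // -/y0 (pq n (leqnn n)) /q subnn /p.
by rewrite [X in _ + X = _]big_geq // addr0 [X in _ - X]big_geq // subr0.
Qed.

(** The vectors [e], in order at [x] and reversed at [z], become the standard basis after
    multiplication by [invmx E]; the first vector at [y], their sum, becomes the all-ones vector. *)
Lemma adapted_start x y z : uniq [:: x; y; z] ->
  exists b, [/\ adapted v b, rational_flag S b x, rational_flag S b z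
    & rational S (b y 0%N)].
Proof.
move=> u; have [e [a [c [ea ec ye]]]] := adapted_frame u.
have [xz yx yz] : [/\ z != x, y != x & y != z].
  by move: u; rewrite /= !inE negb_or (eq_sym z) (eq_sym y x) => /and3P[/andP[-> ->] ->].
pose b1 r i := if (r == x) && (i < n)%N then e i else v r i.
have a1 : adapted v b1 := adapted_flag ea (adapted_refl v).
pose b2 r i := if (r == z) && (i < n)%N then e (n - i.+1)%N else b1 r i.
have a2 : adapted v b2.
  apply: (adapted_flag (c := c)) a1 => i ni; have [ci eci] := ec i ni; split=> //.
  by rewrite eci; apply: eq_bigr => j _; rewrite /b1 (negPf xz).
pose E := rows (mkseq e n).
have E0 : \det E != 0.
  have s : (n + 0 + 0 = n)%N by rewrite !addn0.
  have := adapted_neq0 a2 u s (v_neq0 u s).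
  rewrite /flag_det cats0 (_ : mkseq (b2 x) n = mkseq e n) //.
  apply/eq_in_map => i; rewrite mem_iota add0n => /andP[_ ni].
  by rewrite /b2 /b1 eq_sym (negPf xz) eqxx ni.
have Eu : E \in unitmx by rewrite unitmxE unitfE.
have re i : (i < n)%N -> rational S (e i *m invmx E).
  move=> ni j.
  have -> : e i = row (Ordinal ni) E by rewrite rowK nth_mkseq.
  rewrite -row_mul mulmxV // row1 mxE; case: (_ && _); [exact: subf1 hS|exact: subf0 hS].
exists (fun r i => b2 r i *m invmx E); split.
- by apply: adapted_mulmx => //; rewrite det_inv invr_eq0.
- by move=> i ni; rewrite /b2 /b1 eq_sym (negPf xz) eqxx ni; exact: re.
- by move=> i ni; rewrite /b2 eqxx ni; apply: re; lia.
- rewrite /b2 /b1 (negPf yz) (negPf yx) ye mulmx_suml.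
  by apply: (rational_sum_nat hS) => i /andP[_ ni]; exact: re.
Qed.

End Start.

(** * Existence of triangles on the edges *)

Section Apex.
Variables (k : nat) (T : {set {set 'I_k}}).
Hypothesis hT : ideal_triangulation T.

Lemma set2_eq (a b c d : 'I_k) : [set a; b] = [set c; d] ->
  (a = c /\ b = d) \/ (a = d /\ b = c).
Proof.
move=> e.
have : a \in [set c; d] by rewrite -e set21.
have : b \in [set c; d] by rewrite -e set22.
have : c \in [set a; b] by rewrite e set21.
have : d \in [set a; b] by rewrite e set22.
by rewrite !inE; do 4!(case/orP => /eqP ?); subst; auto.
Qed.

(** By maximality of [T]: adding an edge that crosses nothing in [T] keeps the set noncrossing. *)
Lemma uncrossed_edge (a b : 'I_k) : a != b ->
  (forall c d, [set c; d] \in T -> cyc a c b -> cyc b d a -> False) ->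
  [set a; b] \in T.
Proof.
move=> ab h; have /maxsetP[nc mx] := hT.
rewrite -(mx ([set a; b] |: T)) ?setU11 ?subsetUr //.
have nT := triangulation_noncrossing hT.
have ncr e f : e \in [set a; b] |: T -> f \in [set a; b] |: T -> ~~ crossing e f.
  rewrite !in_setU1 => eT fT; apply/existsP => -[p /existsP[q /existsP[r /existsP[s]]]].
  case/and4P=> /eqP ee /eqP ff c1 c2.
  case/orP: eT => [/eqP ea|eT]; case/orP: fT => [/eqP fa|fT].
  - have := etrans (esym ee) (etrans ea (etrans (esym fa) ff)) => /set2_eq.
    by case=> -[e1 e2]; move: c1 c2; rewrite e1 e2 /cyc; clear; lia.
  - rewrite ff in fT; rewrite ee in ea; case: (set2_eq ea) => [[e1 e2]|[e1 e2]]; subst.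
      exact: (h q s fT).
    by apply: (h s q) => //; rewrite setUC.
  - rewrite ee in eT; rewrite ff in fa; case: (set2_eq fa) => [[e1 e2]|[e1 e2]]; subst.
      by apply: (h r p); [rewrite setUC | |]; move: c1 c2; rewrite // /cyc; clear; lia.
    by apply: (h p r); move: c1 c2; rewrite // /cyc; clear; lia.
  - by rewrite ee in eT; rewrite ff in fT; exact: (edges_noncrossing hT eT fT c1 c2).
apply/forall_inP => e eT; apply/andP; split; last by apply/forall_inP => f; exact: ncr.
move: eT; rewrite in_setU1 => /orP[/eqP ->|eT]; first by rewrite cards2 ab.
by have /forall_inP/(_ _ eT)/andP[] := nT.
Qed.

Lemma side_edge (a b : 'I_k) : b = a.+1 :> nat -> [set a; b] \in T.
Proof.
move=> ab; apply: uncrossed_edge; first by rewrite ord_eqE ab; clear; lia.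
by move=> c d _; rewrite /cyc ab; clear; lia.
Qed.

(** Take for [c] the last neighbour of [a] before [b]. An edge crossing [cb] without crossing [ab]
    or [ac] would join [a] to a point between [c] and [b], against this choice. *)
Lemma apex (a b : 'I_k) : (a.+1 < b)%N -> [set a; b] \in T ->
  exists2 c : 'I_k, (a < c < b)%N & [set a; c] \in T /\ [set c; b] \in T.
Proof.
move=> ab abT; pose P c := (a < nat_of_ord c < b)%N && ([set a; c] \in T).
have a1k : (a.+1 < k)%N by apply: ltn_trans ab _.
have Pc0 : P (Ordinal a1k) by rewrite /P /= ltnSn ab side_edge.
have := arg_maxnP (fun c : 'I_k => nat_of_ord c) Pc0.
case=> c /andP[acb acT] cmax; exists c => //; split=> //.
apply: uncrossed_edge; first by rewrite ord_eqE; move: acb; clear; lia.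
move=> d e deT c1 c2.
have edT : [set e; d] \in T by rewrite setUC.
have n1 := edges_noncrossing hT abT deT; have n2 := edges_noncrossing hT acT edT.
have db : (c < d < b)%N by move: c1 acb; rewrite /cyc; clear; lia.
have [ea|ea] := eqVneq e a.
  rewrite ea in edT; have := cmax d; rewrite /P edT andbT.
  by move: acb db; clear; lia.
by move: ea n1 n2 acb db c2; rewrite /cyc ord_eqE; clear; lia.
Qed.

End Apex.

(** * Propagation of rational bases over the polygon *)

Section Propagation.
Variables (F : fieldType) (k n : nat) (T : {set {set 'I_k}}).
Hypothesis hT : ideal_triangulation T.
Local Notation family := ('I_k -> nat -> 'rV[F]_n).
Variable S : F -> Prop.
Hypothesis hS : subfield S.
Variable v : family.
Hypothesis v_neq0 : forall x y z i j l, uniq [:: x; y; z] -> (i + j + l = n)%N ->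
  flag_det v x y z i j l != 0.
Hypothesis face_in : forall x y z m l p, cyc x y z -> triangle T x y z ->
  (0 < m)%N -> (0 < l)%N -> (0 < p)%N -> (m + l + p = n)%N -> S (flag_face v x y z m l p).
Hypothesis edge_in : forall x y z t m, cyc x y z -> triangle T x y z ->
  cyc x z t -> triangle T x z t -> (0 < m)%N -> (m < n)%N -> S (flag_edge v x y z t m).

(** The edge coordinate on [ab] and the face coordinates of the triangle with apex [c] make the flag
    at [c] rational. The intervals on both sides of [c] follow by induction on length, the triangle
    [a c b] taking the place of [b w a]. *)
Lemma extend_interval d (a b w : 'I_k) (f : family) : (b - a <= d)%N -> (a < b)%N ->
  cyc b w a -> triangle T b w a -> adapted v f ->
  rational_flag S f a -> rational_flag S f b -> rational_flag S f w ->
  exists f', [/\ adapted v f', forall (r : 'I_k) i, ~~ (a < r < b)%N -> f' r i = f r i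
    & forall r : 'I_k, (a < r < b)%N -> rational_flag S f' r].
Proof.
elim: d a b w f => [|d IH] a b w f; first by move=> h1 h2; exfalso; move: h1 h2; clear; lia.
move=> bad ab bwa t vf ra rb rw.
have [ba|ab1] := leqP b a.+1.
  by exists f; split=> // r h; exfalso; move: h ba; clear; lia.
have abT : [set a; b] \in T by case/and3P: t => _ _; rewrite setUC.
have [c acb [acT cbT]] := apex hT ab1 abT.
have bac : cyc b a c by move: acb; rewrite /cyc; clear; lia.
have acb' : cyc a c b by apply: cyc_rot.
have tbac : triangle T b a c by rewrite /triangle setUC abT acT setUC cbT.
have tacb : triangle T a c b by rewrite -triangle_rot.
have [f1 [v1 e1 r1]] := extend_flag hS v_neq0 face_in acb' tacb vf ra rb
  (edge_line_ratio hS v_neq0 edge_in bwa t bac tbac vf rb rw ra).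
have ne (r : 'I_k) : ~~ (a < r < b)%N -> r != c.
  by apply: contra => /eqP ->.
have r1a : rational_flag S f1 a.
  by move=> i /ra; rewrite e1 // ne //; clear; lia.
have r1b : rational_flag S f1 b.
  by move=> i /rb; rewrite e1 // ne //; clear; lia.
have [||||f2 [v2 e2 r2]] := IH a c b f1 _ _ _ _ v1 r1a r1 r1b.
- by move: bad acb; clear; lia.
- by case/andP: acb.
- by do 2!apply: cyc_rot.
- by rewrite -triangle_rot.
have r2a : rational_flag S f2 a.
  by move=> i /r1a; rewrite e2 //; clear; lia.
have r2b : rational_flag S f2 b.
  by move=> i /r1b; rewrite e2 //; move: acb; clear; lia.
have r2c : rational_flag S f2 c.
  by move=> i /r1; rewrite e2 //; clear; lia.
have [||||f3 [v3 e3 r3]] := IH c b a f2 _ _ _ _ v2 r2c r2b r2a.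
- by move: bad acb; clear; lia.
- by case/andP: acb.
- exact: bac.
- exact: tbac.
exists f3; split=> //.
- move=> r i h; rewrite e3; last by move: h acb; clear; lia.
  by rewrite e2; [rewrite e1 // ne | move: h acb; clear; lia].
- move=> r h; have [cr|cr|cr] := ltngtP c r.
  + by apply: r3; move: h cr; clear; lia.
  + move=> i /(r2 r ltac:(move: h cr; clear; lia)); rewrite e3 //.
    by move: cr; clear; lia.
  + have <- : c = r by apply: val_inj.
    by move=> i /r2c; rewrite e3 //; clear; lia.
Qed.

(** The starting triangle is the one on the side joining the first and the last marked point; the
    others lie in the two intervals cut off by its apex. *)
Lemma rational_family : (2 < k)%N -> exists f, adapted v f /\ forall r, rational_flag S f r.
Proof.
move=> k3; have k0 : (0 < k)%N by apply: ltn_trans k3.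
have k1 : (k.-1 < k)%N by rewrite prednK.
pose a := Ordinal k0; pose b := Ordinal k1.
have abT : [set a; b] \in T.
  apply: (uncrossed_edge hT); first by rewrite ord_eqE /=; move: k3; clear; lia.
  move=> c d _; rewrite /cyc /=; have := ltn_ord c; have := ltn_ord d.
  by move: k3; clear; lia.
have [|c acb [acT cbT]] := apex hT _ abT; first by rewrite /=; move: k3; clear; lia.
have acb' : cyc a c b by rewrite /cyc acb.
have u := cyc_uniq acb'.
have t : triangle T a c b by rewrite /triangle acT cbT abT.
have [f0 [v0 ra0 rb0 rc0]] := adapted_start hS v_neq0 u.
(* These minors contain only the first vector at [c], which the starting frame makes rational. *)
have lr : line_ratio S f0 a c b.
  move=> m m0 mn; apply: (subf_div hS); apply: (S_flag_det hS); try (clear -m0 mn; lia);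
   move=> h hh; first [ by case: h hh | by apply: ra0; clear -hh m0 mn; lia
                      | by apply: rb0; clear -hh m0 mn; lia ].
have [f1 [v1 e1 r1]] := extend_flag hS v_neq0 face_in acb' t v0 ra0 rb0 lr.
have ac : a != c by rewrite ord_eqE; move: acb; clear; lia.
have bc : b != c by rewrite ord_eqE; move: acb; clear; lia.
have r1a : rational_flag S f1 a by move=> i /ra0; rewrite e1.
have r1b : rational_flag S f1 b by move=> i /rb0; rewrite e1.
have cba : cyc c b a by apply: cyc_rot.
have bac : cyc b a c by apply: cyc_rot.
have [||f2 [v2 e2 r2]] := extend_interval (leqnn _) _ cba _ v1 r1a r1 r1b.
- by case/andP: acb.
- by rewrite -triangle_rot.
have r2a : rational_flag S f2 a by move=> i /r1a; rewrite e2 //; clear; lia.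
have r2b : rational_flag S f2 b.
  by move=> i /r1b; rewrite e2 //; move: acb; clear; lia.
have r2c : rational_flag S f2 c by move=> i /r1; rewrite e2 //; clear; lia.
have [||f3 [v3 e3 r3]] := extend_interval (leqnn _) _ bac _ v2 r2c r2b r2a.
- by case/andP: acb.
- by rewrite -2!triangle_rot.
exists f3; split=> // r.
have r3a : rational_flag S f3 a by move=> i /r2a; rewrite e3 //; move: acb; clear; lia.
have r3b : rational_flag S f3 b by move=> i /r2b; rewrite e3 //; clear; lia.
have r3c : rational_flag S f3 c by move=> i /r2c; rewrite e3 //; clear; lia.
have [-> //|ra] := eqVneq r a; have [-> //|rb] := eqVneq r b; have [-> //|rc] := eqVneq r c.
have [cr|cr] := ltnP c r.
  apply: r3; rewrite cr /=; move: rb; rewrite ord_eqE /=; have := ltn_ord r; clear; lia.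
have arc : (a < r < c)%N by move: ra rc cr; rewrite !ord_eqE /=; clear; lia.
by move=> i /(r2 r arc); rewrite e3 //; move: cr; clear; lia.
Qed.

End Propagation.

(** * Independence of the coordinate field from the triangulation *)

Section CoordinateChange.
Variables (K : fieldType) (k n : nat).
Local Notation F := (conf_field K k n).

Definition generic_family (r : 'I_k) (i : nat) : 'rV[F]_n :=
  if insub i is Some j then @generic_vec K k n (r, j) else 0.

Lemma mkseq_generic_family r a : (a <= n)%N ->
  mkseq (generic_family r) a = map (@generic_vec K k n) (block n r a).
Proof.
move=> an; rewrite /block map_take -map_comp.
apply: (@eq_from_nth _ 0) => [|i].
  by rewrite size_mkseq size_takel // size_map size_enum_ord.
rewrite size_mkseq => ia; have ni := leq_trans ia an.
rewrite nth_mkseq // nth_take // /generic_family insubT.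
rewrite (nth_map (Ordinal ni)) ?size_enum_ord //=; congr (generic_vec _ (_, _)).
by apply: ord_inj; rewrite nth_enum_ord.
Qed.

Lemma flag_det_generic x y z i j l : (i + j + l = n)%N ->
  flag_det generic_family x y z i j l =
  Omega (bvec K n x i ++ bvec K n y j ++ bvec K n z l).
Proof.
by move=> s; rewrite /flag_det !bvec_block !mkseq_generic_family //; clear -s; lia.
Qed.

Lemma flag_det_generic_neq0 (x y z : 'I_k) i j l : uniq [:: x; y; z] -> (i + j + l = n)%N ->
  flag_det generic_family x y z i j l != 0.
Proof.
move=> u s; rewrite flag_det_generic // !bvec_block -!map_cat.
by have [us sn _ _] := initial_blocks u s; exact: Omega_generic_neq0.
Qed.

Lemma flag_face_generic x y z m l p : (0 < m)%N -> (0 < l)%N -> (0 < p)%N ->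
  (m + l + p = n)%N -> flag_face generic_family x y z m l p = Xtri K n x y z m l p.
Proof.
move=> m0 l0 p0 s; rewrite /flag_face /Xtri !flag_det_generic //; clear -m0 l0 p0 s; lia.
Qed.

Lemma flag_edge_generic x y z t m : (0 < m)%N -> (m < n)%N ->
  flag_edge generic_family x y z t m = Xedge K n x y z t m.
Proof.
by move=> m0 mn; rewrite /flag_edge /Xedge !flag_det_generic //; clear -m0 mn; lia.
Qed.

Lemma subfield_FX T : subfield (@FX K k n T).
Proof.
split; [exact: FX0 | exact: FX1 | | by move=> *; apply: FX_mul | by move=> *; apply: FX_inv].
move=> f g Ff Fg; apply: FX_add => //.
have -> : - g = const k n (-1 : K) * g.
  by rewrite /const mpoly.mpolyCN tofracN -/(const k n 1) const1 mulN1r.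
by apply: FX_mul => //; constructor.
Qed.

Lemma FX_sub T T' : (2 < k)%N -> ideal_triangulation T ->
  forall f : F, FX T' f -> FX T f.
Proof.
move=> k3 hT; have hS := subfield_FX T.
have [||b [vb rb]] := rational_family hT hS flag_det_generic_neq0 _ _ k3.
- move=> x y z m l p xyz t m0 l0 p0 s; rewrite flag_face_generic //.
  by apply: FX_coord; apply: FGcoord_tri.
- move=> x y z t m xyz t1 xzt t2 m0 mn; rewrite flag_edge_generic //.
  by apply: FX_coord; apply: FGcoord_edge.
have Sb x y z i j l : (i + j + l = n)%N -> @FX K k n T (flag_det b x y z i j l).
  by move=> s; apply: (S_flag_det hS) => // h hh; apply: rb; clear -s hh; lia.
move=> f; elim=> [c|V X|f' g _ If _ Ig|f' g _ If _ Ig|f' _ If].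
- exact: FX_const.
- case=> [x y z m l p xyz _ m0 l0 p0 s|x y z t m xyz _ xzt _ m0 mn].
    (* Invariance replaces the generic vectors by those of [b], with entries in [FX T]. *)
    rewrite -flag_face_generic // -(flag_face_adapted vb flag_det_generic_neq0 (cyc_uniq xyz)) //.
    by apply: (subfM hS); [apply: (subfM hS)|]; apply: (subf_div hS); apply: Sb;
      clear -m0 l0 p0 s; lia.
  rewrite -flag_edge_generic //.
  rewrite -(flag_edge_adapted vb flag_det_generic_neq0 (cyc_uniq xyz) (cyc_uniq xzt)) //.
  by apply: (subf_div hS); apply: (subfM hS); apply: Sb; clear -m0 mn; lia.
- exact: FX_add.
- exact: FX_mul.
- exact: FX_inv.
Qed.

End CoordinateChange.

Theorem corollary6p3 (K : fieldType) (charK : [pchar K] =i pred0)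
    (n k : nat) (hn : (2 <= n)%N) (hk : (3 <= k)%N)
    (T T' : {set {set 'I_k}})
    (hT : ideal_triangulation T) (hT' : ideal_triangulation T') :
  (forall f : conf_field K k n, FX T' f -> FX T f) /\
  (forall B B' : conf_field K k n -> conf_field K k n -> conf_field K k n,
     FGbracket T B -> FGbracket T' B' ->
     forall f g : conf_field K k n, FX T' f -> FX T' g -> B' f g = B f g).
Proof.
have sub : forall f : conf_field K k n, FX T' f -> FX T f by exact: FX_sub.
split=> // B B' hB hB' f g Ff Fg.
(* On [FX T'], contained in [FX T], both brackets restrict the same triangulation-free [bracket]. *)
rewrite (FGbracket_unique charK hT' hB' Ff Fg).
by rewrite (FGbracket_unique charK hT hB (sub f Ff) (sub g Fg)).
Qed.
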